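(* Let $L$ be a countably categorical linear order. Then the automorphism group $\mathrm{Aut}(L)$, with the topology of pointwise convergence, is extremely amenable.
   Context: A countably categorical linear order is a countable (possibly finite) linear order $L$ such that every countable linear order satisfying the same first-order theory as $L$ (in the language of linear orders) is isomorphic to $L$. A topological group $G$ is extremely amenable if every continuous action of $G$ on a compact Hausdorff space has a fixed point. *)

(* Defs.v *)
From HB Require Import structures.
From mathcomp Require Import all_boot all_order.
From mathcomp Require Import boolp classical_sets functions cardinality.
From mathcomp Require Import topology function_spaces.

Set Implicit Arguments.
Unset Strict Implicit.
Unset Printing Implicit Defensive.

Import Order.TTheory.

Local Open Scope classical_set_scope.

(* [formula n] is the type of formulas, in the language of orders with
   equality, whose free variables are among the n variables 'I_n. Under a
   quantifier the bound variable is [ord0] and the variable i of the context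
   becomes [lift ord0 i]. Keeping the free variables in the type lets sentences
   ([formula 0]) be evaluated in the empty order as well. *)
Inductive formula : nat -> Type :=
| FEq n (i j : 'I_n) : formula n
| FLe n (i j : 'I_n) : formula n
| FFalse n : formula n
| FImp n (p q : formula n) : formula n
| FAll n (p : formula n.+1) : formula n.

Definition env_cons (T : Type) n (x : T) (v : 'I_n -> T) (i : 'I_n.+1) : T :=
  if unlift ord0 i is Some j then v j else x.

Definition env_nil (T : Type) (i : 'I_0) : T :=
  False_rect T (notF (valP i)).

Fixpoint sat d (L : orderType d) n (p : formula n) : ('I_n -> L) -> Prop :=
  match p in formula n return ('I_n -> L) -> Prop with
  | FEq _ i j => fun v => v i = v j
  | FLe _ i j => fun v => (v i <= v j)%O
  | FFalse _ => fun=> False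
  | FImp _ p q => fun v => sat p v -> sat q v
  | FAll _ p => fun v => forall x : L, sat p (env_cons x v)
  end.

Definition models d (L : orderType d) (p : formula 0) : Prop :=
  sat p (@env_nil L).

Definition elementarily_equivalent d (L : orderType d) d' (M : orderType d') :=
  forall p : formula 0, models L p <-> models M p.

Definition order_isomorphic d (L : orderType d) d' (M : orderType d') :=
  exists f : L -> M, bijective f /\ {mono f : x y / (x <= y)%O}.

Definition countably_categorical d (L : orderType d) : Prop :=
  countable [set: L] /\
  forall d' (M : orderType d'), countable [set: M] ->
    elementarily_equivalent M L -> order_isomorphic M L.

HB.structure Definition PreTopologicalGroup := {G of Group G & Topological G}.

HB.mixin Record PreTopologicalGroup_isTopologicalGroup G
    of PreTopologicalGroup G := {
  mulg_continuous : continuous (fun p : G * G => (p.1 * p.2)%g);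
  invg_continuous : continuous (fun x : G => x^-1%g)
}.

#[short(type="topologicalGroupType")]
HB.structure Definition TopologicalGroup :=
  {G of PreTopologicalGroup G & PreTopologicalGroup_isTopologicalGroup G}.

Definition continuous_action (G : topologicalGroupType) (X : topologicalType)
    (act : G -> X -> X) : Prop :=
  [/\ forall x, act 1%g x = x,
      forall g h x, act (g * h)%g x = act g (act h x)
    & continuous (fun p : G * X => act p.1 p.2)].

Definition extremely_amenable (G : topologicalGroupType) : Prop :=
  forall X : topologicalType,
    [set: X] !=set0 -> compact [set: X] -> hausdorff_space X ->
    forall act : G -> X -> X, continuous_action act ->
    exists x : X, forall g : G, act g x = x.

Record order_aut d (L : orderType d) := OrderAut {
  aut_fun :> L -> L;
  aut_bij : bijective aut_fun;
  aut_mono : {mono aut_fun : x y / (x <= y)%O}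
}.

Section OrderAut.
Context {d : Order.disp_t} {L : orderType d}.
Notation aut := (order_aut L).
Implicit Types f g h : aut.

HB.instance Definition _ := gen_eqMixin aut.
HB.instance Definition _ := gen_choiceMixin aut.

Lemma order_autP f g : f =1 g -> f = g.
Proof.
case: f g => [f fb fm] [g gb gm] /= /funext fg; subst g.
by rewrite (Prop_irrelevance fb gb) (Prop_irrelevance fm gm).
Qed.

Definition aut_one : aut := 
  @OrderAut _ L id (Bijective (fun _ => erefl) (fun _ => erefl))
    (fun _ _ => erefl).

Definition aut_mul f g : aut :=
  OrderAut (bij_comp (aut_bij f) (aut_bij g))
    (fun x y => etrans (aut_mono f (g x) (g y)) (aut_mono g x y)).

Lemma aut_inv_subproof f : exists g : L -> L, cancel f g /\ cancel g f.
Proof. by case: (aut_bij f) => g fK gK; exists g. Qed.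

Definition aut_inv_fun f : L -> L := sval (cid (aut_inv_subproof f)).

Lemma aut_funK f : cancel f (aut_inv_fun f).
Proof. by rewrite /aut_inv_fun; case: cid => g []. Qed.

Lemma aut_inv_funK f : cancel (aut_inv_fun f) f.
Proof. by rewrite /aut_inv_fun; case: cid => g []. Qed.

Lemma aut_inv_mono f : {mono aut_inv_fun f : x y / (x <= y)%O}.
Proof. by move=> x y; rewrite -(aut_mono f) !aut_inv_funK. Qed.

Definition aut_inv f : aut :=
  OrderAut (Bijective (aut_inv_funK f) (aut_funK f)) (@aut_inv_mono f).

Lemma aut_mulA : associative aut_mul.
Proof. by move=> f g h; apply: order_autP. Qed.

Lemma aut_mul1 : left_id aut_one aut_mul.
Proof. by move=> f; apply: order_autP. Qed.

Lemma aut_mulr1 : right_id aut_one aut_mul.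
Proof. by move=> f; apply: order_autP. Qed.

Lemma aut_mulV : left_inverse aut_one aut_inv aut_mul.
Proof. by move=> f; apply: order_autP => x; exact: aut_funK. Qed.

Lemma aut_mulrV : right_inverse aut_one aut_inv aut_mul.
Proof. by move=> f; apply: order_autP => x; exact: aut_inv_funK. Qed.

HB.instance Definition _ :=
  isGroup.Build aut aut_mulA aut_mul1 aut_mulr1 aut_mulV aut_mulrV.

(* Pointwise convergence is with respect to the discrete topology on L, not
   its order topology. *)
Definition aut_ptws f : {ptws L -> discrete_topology L} := aut_fun f.

HB.instance Definition _ := Topological.copy aut (initial_topology aut_ptws).

Lemma near_aut (f : aut) (x : L) : nbhs f [set g : aut | g x = f x].
Proof.
move: f; suff cx : continuous (fun g : aut => g x : discrete_topology L).
  by move=> f; apply: (cx f [set f x]); exact: discrete_set1.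
move=> f; apply: (@continuous_comp aut _ _ aut_ptws (@^~ x) f).
  exact: initial_continuous.
exact: (@proj_continuous _ (fun=> discrete_topology L) x).
Qed.

Lemma continuous_into_aut (X : topologicalType) (F : X -> aut) :
  (forall u x, nbhs u [set v | F v x = F u x]) -> continuous F.
Proof.
move=> FE; apply: continuous_comp_initial => u.
apply/cvg_sup => x; apply: continuous_comp_initial => {}u.
apply/discrete_cvg; exact: FE.
Qed.

Lemma aut_mul_continuous : continuous (fun p : aut * aut => (p.1 * p.2)%g).
Proof.
apply: continuous_into_aut => -[f g] x.
exists ([set f' : aut | f' (g x) = f (g x)], [set g' : aut | g' x = g x]).
  by split; exact: near_aut.
by move=> [f' g'] [/= ff' gg']; rewrite /= gg' ff'.
Qed.

Lemma aut_inv_continuous : continuous (fun f : aut => (f^-1)%g).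
Proof.
apply: continuous_into_aut => f x.
apply: filterS (near_aut f (aut_inv_fun f x)) => g /=.
by rewrite aut_inv_funK => gx; rewrite -[in LHS]gx; exact: aut_funK.
Qed.

HB.instance Definition _ := PreTopologicalGroup_isTopologicalGroup.Build aut
  aut_mul_continuous aut_inv_continuous.

End OrderAut.

(* Main.v *)
(* By a Ryll-Nardzewski argument Aut(L) has finitely many orbits on pairs: an
   ultrapower shows that L realizes every limit of types, hence isolated types
   are dense, hence L has an atomic elementary substructure, which is isomorphic
   to L, and so only finitely many types of each arity occur.

   Extreme amenability follows by induction on the number of orbits on pairs.
   An invariant cut, or else a maximal invariant convex equivalence relation,
   gives a quotient L -> Q whose fibers have fewer pair orbits. By induction
   and compactness the kernel of the action on Q has a fixed point in every
   compact flow. For a cut the kernel is the whole group. Otherwise every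
   orbit in Q is dense, so Aut(L) induces on Q the automorphism group of a
   homogeneous coloured order. Ramsey's theorem for such orders yields a
   fixed point of Aut(L) in the closed invariant set of the points fixed by
   the kernel. *)

Require Import Defs.
From HB Require Import structures.
From mathcomp Require Import all_boot all_order.
From mathcomp Require Import boolp classical_sets functions cardinality filter.
From mathcomp Require Import topology function_spaces subtype_topology.

Set Implicit Arguments.
Unset Strict Implicit.
Unset Printing Implicit Defensive.

Import Order.TTheory.

Local Notation all_aut L := [set: order_aut L]%classic.

(** * Automorphisms, suborders and quotients of linear orders *)

Lemma dependent_choice_from (S : Type) (P : S -> Prop)
    (R : nat -> S -> S -> Prop) (s0 : S) :
  P s0 -> (forall n s, P s -> exists2 s', P s' & R n s s') ->
  exists f : nat -> S,
    [/\ f 0 = s0, forall n, P (f n) & forall n, R n (f n) (f n.+1)].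
Proof.
move=> Ps0 step.
have /choice[next nextP] (p : nat * S) :
    exists s', P p.2 -> P s' /\ R p.1 p.2 s'.
  have [/(step p.1)[s' Ps' ss']|nP] := pselect (P p.2); first by exists s'.
  by exists s0 => /nP.
pose f := fix f n := if n is m.+1 then next (m, f m) else s0.
have fP n : P (f n) by elim: n => // n /(nextP (n, f n))[].
by exists f; split=> // n; have [] := nextP (n, f n) (fP n).
Qed.

Lemma increasing_chain (T : eqType) (P : seq T -> Prop)
    (W : nat -> seq T -> seq T -> Prop) (s0 : seq T) :
  P s0 ->
  (forall n s, P s -> exists s', [/\ P s', {subset s <= s'} & W n s s']) ->
  exists f : nat -> seq T, [/\ f 0 = s0, forall n, P (f n),
    {homo f : m n / m <= n >-> {subset m <= n}} &
    forall n, W n (f n) (f n.+1)].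
Proof.
move=> Ps0 step; have [//|n s /(step n)[s' [? ? ?]]|f [f0 fP fR]] :=
  @dependent_choice_from _ P (fun n s s' => {subset s <= s'} /\ W n s s') s0.
  by exists s'.
exists f; split=> // [|n]; last exact: (fR n).2.
by apply: homo_leq => [s //|s t u st tu p /st/tu //|n]; exact: (fR n).1.
Qed.

Section Automorphisms.
Context {d : Order.disp_t} {L : orderType d}.
Implicit Types g h : order_aut L.

Lemma aut1E x : (1%g : order_aut L) x = x. Proof. by []. Qed.

Lemma autME g h x : (g * h)%g x = g (h x). Proof. by []. Qed.

Lemma autK g : cancel g (g^-1)%g. Proof. exact: aut_funK. Qed.

Lemma autVK g : cancel (g^-1)%g g. Proof. exact: aut_inv_funK. Qed.

Lemma aut_lt g : {mono g : x y / (x < y)%O}.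
Proof. exact: leW_mono (aut_mono g). Qed.

Lemma le_aut_inv g x y : (x <= g y)%O = ((g^-1)%g x <= y)%O.
Proof. by rewrite -(aut_mono g^-1%g) autK. Qed.

Lemma lt_aut_inv g x y : (x < g y)%O = ((g^-1)%g x < y)%O.
Proof. by rewrite -(aut_lt g^-1%g) autK. Qed.

Lemma order_relation_aut (R : L -> L -> Prop) :
  (forall x, exists y, R x y) -> (forall y, exists x, R x y) ->
  (forall x y x' y', R x y -> R x' y' -> (x <= x')%O = (y <= y')%O) ->
  exists g : order_aut L, forall x y, R x y -> g x = y.
Proof.
move=> /choice[f fP] /choice[f' f'P] R_mono.
have f_unique x y : R x y -> f x = y.
  by move=> xy; apply/le_anti; rewrite -(R_mono _ _ _ _ (fP x) xy)
    -(R_mono _ _ _ _ xy (fP x)) lexx.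
have f'_unique x y : R x y -> f' y = x.
  by move=> xy; apply/le_anti; rewrite (R_mono _ _ _ _ (f'P y) xy)
    (R_mono _ _ _ _ xy (f'P y)) lexx.
have fK : cancel f f' by move=> x; exact/f'_unique/fP.
have f'K : cancel f' f by move=> y; exact/f_unique/f'P.
by exists (OrderAut (Bijective fK f'K)
  (fun x y => esym (R_mono _ _ _ _ (fP x) (fP y)))).
Qed.

End Automorphisms.

Section BackAndForth.
Context {d : Order.disp_t} (L : orderType d).
Variables (P : seq (L * L) -> Prop) (s0 : seq (L * L)).
Hypothesis L_countable : countable [set: L].
Hypothesis P0 : P s0.
Hypothesis P_forth : forall s x, P s -> exists y, P ((x, y) :: s).
Hypothesis P_back : forall s y, P s -> exists x, P ((x, y) :: s).
Hypothesis P_mono : forall s, P s ->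
  {in s &, forall p q, (p.1 <= q.1)%O = (p.2 <= q.2)%O}.

Lemma back_and_forth : exists g : order_aut L,
  {in s0, forall p, g p.1 = p.2} /\ forall x, exists2 s, P s & (x, g x) \in s.
Proof.
have /countable_injP[rank rank_inj] := L_countable.
have {}rank_inj : injective rank by move=> x y; apply: rank_inj; rewrite inE.
pose handles n (s' : seq (L * L)) := forall x, rank x = n ->
  (exists y, (x, y) \in s') /\ exists y, (y, x) \in s'.
have [|n s Ps|f [f0 fP f_mono fW]] :=
    @increasing_chain _ P (fun n _ => handles n) s0.
- exact: P0.
- have [[x xn]|nx] := pselect (exists x, rank x = n); last first.
    by exists s; split=> // x xn; case: nx; exists x.
  have [y Py] := P_forth x Ps; have [z Pz] := P_back x Py.
  exists [:: (z, x), (x, y) & s]; split=> // [p ps|x' x'n].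
    by rewrite !inE ps !orbT.
  have -> : x' = x by apply: rank_inj; rewrite x'n.
  by split; [exists y|exists z]; rewrite !inE eqxx ?orbT.
pose R x y := exists n, (x, y) \in f n.
have [|||g gP] := @order_relation_aut _ L R.
- by move=> x; have [[y xy] _] := fW _ x erefl; exists y, (rank x).+1.
- by move=> y; have [_ [x xy]] := fW _ y erefl; exists x, (rank y).+1.
- move=> x y x' y' [m xy] [n xy']; apply: (P_mono (fP (maxn m n))
    (x := (x, y)) (y := (x', y'))).
    exact: (f_mono _ _ (leq_maxl _ _)).
  exact: (f_mono _ _ (leq_maxr _ _)).
exists g; split=> [[x y] xy|x]; first by apply: gP; exists 0; rewrite f0.
have [[y xy] _] := fW _ x erefl.
by exists (f (rank x).+1) => //; rewrite (gP x y) //; exists (rank x).+1.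
Qed.

End BackAndForth.

Definition suborder d (L : orderType d) (P : pred L) : Type := {x | P x}.

HB.instance Definition _ d (L : orderType d) (P : pred L) :=
  SubChoice.on (@suborder d L P).
HB.instance Definition _ d (L : orderType d) (P : pred L) :=
  [SubChoice_isSubOrder of @suborder d L P by <: with d].

Section Suborder.
Context {d : Order.disp_t} {L : orderType d} (P : pred L).
Implicit Types (g : order_aut L) (h : order_aut (suborder P)).

Lemma suborder_countable : countable [set` P] -> countable [set: suborder P].
Proof.
move=> /countable_injP[f f_inj]; apply/countable_injP; exists (f \o val).
by move=> x y _ _ /f_inj xy; apply/val_inj/xy; rewrite inE; exact: valP.
Qed.

Lemma restrict_aut g : (forall x, P (g x) = P x) ->
  exists h, forall u, val (h u) = g (val u).
Proof.
move=> gP; pose R (u v : suborder P) := val v = g (val u).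
have [u|u|u v u' v' uv uv'|h hE] := @order_relation_aut _ _ R.
- have Pgu : P (g (val u)) by rewrite gP; exact: valP.
  by exists (Sub _ Pgu); rewrite /R SubK.
- have Pgu : P ((g^-1)%g (val u)) by rewrite -gP autVK; exact: valP.
  by exists (Sub _ Pgu); rewrite /R SubK autVK.
- by rewrite -!Order.le_val uv uv' aut_mono.
exists h => u; have Pgu : P (g (val u)) by rewrite gP; exact: valP.
have -> : h u = Sub _ Pgu by apply: hE; rewrite /R SubK.
exact: SubK.
Qed.

Hypothesis P_convex :
  forall x y z, P x -> P z -> (x <= y)%O -> (y <= z)%O -> P y.

Lemma extension_exists h : exists g,
  (forall u, g (val u) = val (h u)) /\ forall x, ~~ P x -> g x = x.
Proof.
pose R x y := (exists2 u, x = val u & y = val (h u)) \/ ~~ P x /\ y = x.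
have below x (u v : suborder P) : ~~ P x -> (val u <= x)%O -> (val v <= x)%O.
  move=> /negP Px ux; case: leP => // /ltW xv; case: Px.
  exact: P_convex (valP u) (valP v) ux xv.
have above x (u v : suborder P) : ~~ P x -> (x <= val u)%O -> (x <= val v)%O.
  move=> /negP Px xu; case: leP => // /ltW vx; case: Px.
  exact: P_convex (valP v) (valP u) vx xu.
have R_total x : exists y, R x y.
  have [Px|Px] := boolP (P x); last by exists x; right.
  by exists (val (h (Sub x Px))); left; exists (Sub x Px); rewrite ?SubK.
have [//|y|x y x' y'|g gR] := @order_relation_aut _ L R.
- have [Py|Py] := boolP (P y); last by exists y; right.
  exists (val ((h^-1)%g (Sub y Py))); left.
  by exists ((h^-1)%g (Sub y Py)); rewrite ?autVK ?SubK.
- case=> [[u -> ->]|[Px ->]]; case=> [[u' -> ->]|[Px' ->]] //.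
  + by rewrite !Order.le_val aut_mono.
  + by apply/idP/idP; exact: below.
  + by apply/idP/idP; exact: above.
exists g; split=> [u|x Px]; apply: gR; first by left; exists u.
by right.
Qed.

Definition extension h : order_aut L := sval (cid (extension_exists h)).

Lemma extension_in h u : extension h (val u) = val (h u).
Proof. by rewrite /extension; case: cid => g []. Qed.

Lemma extension_out h x : ~~ P x -> extension h x = x.
Proof. by rewrite /extension; case: cid => g [/= _]; apply. Qed.

Lemma extension_pred h x : P (extension h x) = P x.
Proof.
have [Px|Px] := boolP (P x); last by rewrite extension_out // (negbTE Px).
by rewrite -[x](SubK (suborder P) Px) extension_in; exact: valP.
Qed.

Lemma eq_extension h g : (forall u, g (val u) = val (h u)) ->
  (forall x, ~~ P x -> g x = x) -> extension h = g.
Proof.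
move=> g_in g_out; apply: order_autP => x.
have [Px|Px] := boolP (P x); last by rewrite extension_out // g_out.
by rewrite -[x](SubK (suborder P) Px) extension_in g_in.
Qed.

Lemma extension1 : extension 1%g = 1%g.
Proof. exact: eq_extension. Qed.

Lemma extensionM h h' : extension (h * h')%g = (extension h * extension h')%g.
Proof.
apply: eq_extension => [u|x Px]; rewrite autME; first by rewrite !extension_in.
by rewrite !extension_out.
Qed.

Lemma continuous_extension : continuous extension.
Proof.
apply: continuous_into_aut => h x.
have [Px|Px] := boolP (P x); last first.
  by apply: filterS filterT => h' _ /=; rewrite !extension_out.
apply: filterS (near_aut h (Sub x Px)) => h' /= e.
by rewrite -[x](SubK (suborder P) Px) !extension_in e.
Qed.

End Suborder.

Section PreorderQuotient.
Local Open Scope quotient_scope.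
Variables (T : choiceType) (le : rel T).
Hypotheses (le_trans : transitive le) (le_total : total le).

Definition mutual_le x y := le x y && le y x.

Lemma mutual_le_equiv : equiv_class_of mutual_le.
Proof.
split=> [x|x y|y x z /andP[xy yx] /andP[yz zy]]; rewrite /mutual_le.
- by have := le_total x x; rewrite orbb => ->.
- exact: andbC.
- by rewrite (le_trans xy yz) (le_trans zy yx).
Qed.

Canonical mutual_le_rel := EquivRelPack mutual_le_equiv.

Definition preorder_quotient := {eq_quot mutual_le}.
Definition preorder_pi : T -> preorder_quotient := \pi_({eq_quot mutual_le}).

HB.instance Definition _ := Choice.on preorder_quotient.

Definition quotient_le : rel preorder_quotient :=
  fun p q => le (repr p) (repr q).

Lemma quotient_le_pi x y : quotient_le (preorder_pi x) (preorder_pi y) = le x y.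
Proof.
have repr_pi z : mutual_le (repr (preorder_pi z)) z.
  by apply/eqquotP; exact: reprK.
have /andP[rx xr] := repr_pi x; have /andP[ry yr] := repr_pi y.
apply/idP/idP => h; first exact: le_trans xr (le_trans h ry).
exact: le_trans rx (le_trans h yr).
Qed.

Lemma quotient_le_anti : antisymmetric quotient_le.
Proof. by move=> p q pq; rewrite -[p]reprK -[q]reprK; apply/eqquotP. Qed.

Lemma quotient_le_trans : transitive quotient_le.
Proof. by move=> q p r; exact: le_trans. Qed.

Lemma quotient_le_total : total quotient_le.
Proof. by move=> p q; exact: le_total. Qed.

HB.instance Definition _ := Order.isOrder.Build (Order.Disp tt tt)
  preorder_quotient (fun _ _ => erefl) (fun _ _ => erefl) (fun _ _ => erefl)
  quotient_le_anti quotient_le_trans quotient_le_total.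

Lemma preorder_quotientP :
  exists (Q : orderType (Order.Disp tt tt)) (pi : T -> Q),
    (forall x y, (pi x <= pi y)%O = le x y) /\ forall q, exists x, pi x = q.
Proof.
exists preorder_quotient, preorder_pi; split=> [|q].
  exact: quotient_le_pi.
by exists (repr q); exact: reprK.
Qed.

End PreorderQuotient.

(** * Ehrenfeucht-Fraisse types *)

Lemma env0_eq (T : Type) (v w : 'I_0 -> T) : v = w.
Proof. by apply/funext => -[]. Qed.

Lemma env_cons0 (T : Type) n (x : T) (v : 'I_n -> T) : env_cons x v ord0 = x.
Proof. by rewrite /env_cons unlift_none. Qed.

Lemma env_cons_lift (T : Type) n (x : T) (v : 'I_n -> T) i :
  env_cons x v (lift ord0 i) = v i.
Proof. by rewrite /env_cons liftK. Qed.

Definition env_consE := (env_cons0, env_cons_lift).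

Lemma ord_lift0P n (P : 'I_n.+1 -> Prop) :
  P ord0 -> (forall i, P (lift ord0 i)) -> forall i, P i.
Proof. by move=> P0 PS i; case: (unliftP ord0 i) => [j ->|->]. Qed.

Lemma env_cons_comp (T U : Type) n (f : T -> U) x (v : 'I_n -> T) :
  f \o env_cons x v = env_cons (f x) (f \o v).
Proof. by apply/funext; apply: ord_lift0P => [|i] /=; rewrite !env_consE. Qed.

Lemma env_cons_eta (T : Type) n (v : 'I_n.+1 -> T) :
  env_cons (v ord0) (v \o lift ord0) = v.
Proof. by apply/funext; apply: ord_lift0P => [|i]; rewrite env_consE. Qed.

Definition lift_reindex m n (r : 'I_m -> 'I_n) : 'I_m.+1 -> 'I_n.+1 :=
  env_cons ord0 (lift ord0 \o r).

Lemma env_cons_reindex (T : Type) m n (r : 'I_m -> 'I_n) x (v : 'I_n -> T) :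
  env_cons x (v \o r) = env_cons x v \o lift_reindex r.
Proof.
by apply/funext; apply: ord_lift0P => [|i] /=; rewrite /lift_reindex !env_consE.
Qed.

Definition seq_env (T : Type) (s : seq T) : 'I_(size s) -> T :=
  tnth (in_tuple s).
Arguments seq_env {T} s i.

Lemma seq_env_cons (T : Type) x (s : seq T) :
  env_cons x (seq_env s) = seq_env (x :: s).
Proof.
apply/funext; apply: ord_lift0P => [|i]; rewrite env_consE.
  by rewrite /seq_env (tnth_nth x).
by rewrite /seq_env !(tnth_nth x).
Qed.

Lemma seq_env_reindex (T : eqType) n (v : 'I_n -> T) (s : seq T) :
  (forall i, v i \in s) ->
  exists r : 'I_n -> 'I_(size s), v = seq_env s \o r.
Proof.
move=> vs; have /choice[r rP] i : exists j, v i = seq_env s j.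
  by have /(tnthP (in_tuple s)) := vs i.
by exists r; apply/funext.
Qed.

Fixpoint ef_type (k n : nat) : finType :=
  if k is k'.+1 then ({ffun 'I_n * 'I_n -> bool} * {set ef_type k' n.+1})%type
  else {ffun 'I_n * 'I_n -> bool}.

Definition order_diagram d (L : orderType d) n (v : 'I_n -> L) :=
  [ffun p : 'I_n * 'I_n => (v p.1 <= v p.2)%O].

Fixpoint ef d (L : orderType d) k n (v : 'I_n -> L) : ef_type k n :=
  match k return ef_type k n with
  | 0 => order_diagram v
  | k'.+1 =>
    (order_diagram v, [set t | `[< exists x, ef k' (env_cons x v) = t >]])
  end.

Section TwoOrders.
Context {d d' : Order.disp_t} {L : orderType d} {M : orderType d'}.

Lemma order_diagramP n (v : 'I_n -> L) (w : 'I_n -> M) :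
  order_diagram v = order_diagram w <->
  forall i j, (v i <= v j)%O = (w i <= w j)%O.
Proof.
split=> [/ffunP vw i j|vw]; first by have := vw (i, j); rewrite !ffunE.
by apply/ffunP => -[i j]; rewrite !ffunE.
Qed.

Lemma ef_succP k n (v : 'I_n -> L) (w : 'I_n -> M) :
  ef k.+1 v = ef k.+1 w <->
  [/\ order_diagram v = order_diagram w,
      forall x, exists y, ef k (env_cons x v) = ef k (env_cons y w) &
      forall y, exists x, ef k (env_cons x v) = ef k (env_cons y w)].
Proof.
split=> /= [[-> /setP vw]|[-> forth back]].
  split=> // [x|y].
    have := vw (ef k (env_cons x v)); rewrite !inE => e.
    have /asboolP[y <-] : `[< exists y, ef k (env_cons y w) =
      ef k (env_cons x v) >] by rewrite -e; apply/asboolP; exists x.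
    by exists y.
  have := vw (ef k (env_cons y w)); rewrite !inE => e.
  have /asboolP[x xy] : `[< exists x, ef k (env_cons x v) =
    ef k (env_cons y w) >] by rewrite e; apply/asboolP; exists y.
  by exists x.
congr (_, _); apply/setP => t; rewrite !inE; apply/asboolP/asboolP.
  by move=> [x <-]; have [y xy] := forth x; exists y.
by move=> [y <-]; have [x xy] := back y; exists x.
Qed.

Lemma ef_diagram k n (v : 'I_n -> L) (w : 'I_n -> M) :
  ef k v = ef k w -> order_diagram v = order_diagram w.
Proof. by case: k => [//|k] /ef_succP[]. Qed.

Lemma ef_eq_leq j k n (v : 'I_n -> L) (w : 'I_n -> M) :
  j <= k -> ef k v = ef k w -> ef j v = ef j w.
Proof.
elim: k j n v w => [|k IHk] j n v w; first by rewrite leqn0 => /eqP->.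
case: j => [_|j jk /ef_succP[vw forth back]]; first exact: ef_diagram.
apply/ef_succP; split=> // [x|y].
  by have [y xy] := forth x; exists y; apply: IHk xy.
by have [x xy] := back y; exists x; apply: IHk xy.
Qed.

Lemma ef_eq_reindex k m n (r : 'I_m -> 'I_n) (v : 'I_n -> L) (w : 'I_n -> M) :
  ef k v = ef k w -> ef k (v \o r) = ef k (w \o r).
Proof.
elim: k m n r v w => [|k IHk] m n r v w.
  by move=> /order_diagramP vw; apply/order_diagramP => i j; exact: vw.
move=> /ef_succP[/order_diagramP vw forth back]; apply/ef_succP; split=> [|x|y].
- by apply/order_diagramP => i j; exact: vw.
- have [y xy] := forth x; exists y.
  by rewrite (env_cons_reindex r x) (env_cons_reindex r y); apply: IHk.
- have [x xy] := back y; exists x.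
  by rewrite (env_cons_reindex r x) (env_cons_reindex r y); apply: IHk.
Qed.

Lemma ef_eq_extend m k n (u : 'I_m -> L) (v : 'I_n -> L) (w : 'I_n -> M) :
  ef (k + m) v = ef (k + m) w ->
  exists N (v' : 'I_N -> L) (w' : 'I_N -> M) (a : 'I_m -> 'I_N)
    (b : 'I_n -> 'I_N),
  [/\ ef k v' = ef k w', u = v' \o a, v = v' \o b & w = w' \o b].
Proof.
elim: m n u v w => [|m IHm] n u v w.
  rewrite addn0 => vw; exists n, v, w, (@env_nil 'I_n).
  by exists id; split=> //; exact: env0_eq.
rewrite addnS => /ef_succP[_ forth _]; have [y xy] := forth (u ord0).
have [N [v' [w' [a [b [vw' uE vE wE]]]]]] := IHm _ (u \o lift ord0) _ _ xy.
exists N, v', w', (env_cons (b ord0) a), (b \o lift ord0); split=> //.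
- rewrite env_cons_comp -uE -[v' _]/((v' \o b) ord0) -vE env_cons0.
  exact/esym/env_cons_eta.
- by rewrite compA -vE; apply/funext => i; rewrite /= env_cons_lift.
- by rewrite compA -wE; apply/funext => i; rewrite /= env_cons_lift.
Qed.


Lemma sat_ef n (p : formula n) :
  exists k, forall (v : 'I_n -> L) (w : 'I_n -> M), ef k v = ef k w ->
    (sat p v <-> sat p w).
Proof.
elim: p => {n} [n i j|n i j|n|n p [k IHp] q [l IHq]|n p [k IHp]].
- exists 0 => v w /order_diagramP vw; split=> /= [vij|wij]; apply/le_anti.
    by rewrite -!vw vij lexx.
  by rewrite !vw wij lexx.
- by exists 0 => v w /order_diagramP vw /=; rewrite vw.
- by exists 0.
- exists (maxn k l) => v w vw /=.
  have vwk := IHp _ _ (ef_eq_leq (leq_maxl k l) vw).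
  have vwl := IHq _ _ (ef_eq_leq (leq_maxr k l) vw).
  by split=> pq sp; apply/vwl/pq/vwk.
- exists k.+1 => v w /ef_succP[_ forth back] /=; split=> pv.
    by move=> y; have [x /IHp xy] := back y; apply/xy/pv.
  by move=> x; have [y /IHp xy] := forth x; apply/xy/pv.
Qed.

Lemma ef_elementarily_equivalent :
  (forall k, ef k (@env_nil L) = ef k (@env_nil M)) ->
  elementarily_equivalent L M.
Proof. by move=> LM p; have [k kP] := sat_ef p; exact: kP. Qed.

Definition same_type n (v : 'I_n -> L) (w : 'I_n -> M) :=
  forall k, ef k v = ef k w.

End TwoOrders.

Section ElementaryEmbedding.
Context {d d' : Order.disp_t} {L : orderType d} {M : orderType d'}.

Definition elementary (h : L -> M) :=
  forall n (v : 'I_n -> L), same_type (h \o v) v.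

Lemma tarski_vaught_test (h : L -> M) : {mono h : x y / (x <= y)%O} ->
  (forall k n (v : 'I_n -> L) y, exists x,
    ef k (env_cons y (h \o v)) = ef k (env_cons (h x) (h \o v))) ->
  elementary h.
Proof.
move=> h_mono witness n v k; elim: k n v => [|k IHk] n v.
  by apply/order_diagramP => i j; exact: h_mono.
apply/ef_succP; split=> [|y|x].
- by apply/order_diagramP => i j; exact: h_mono.
- by have [x ->] := witness k n v y; exists x; rewrite -env_cons_comp IHk.
- by exists (h x); rewrite -env_cons_comp IHk.
Qed.

Lemma iso_elementary (f : L -> M) :
  bijective f -> {mono f : x y / (x <= y)%O} -> elementary f.
Proof.
move=> [g _ gK] f_mono; apply: tarski_vaught_test => // k n v y.
by exists (g y); rewrite gK.
Qed.

End ElementaryEmbedding.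

Section DownwardLowenheimSkolem.
Context {d : Order.disp_t} (L : orderType d).
Variable admissible : seq L -> Prop.
Hypothesis admissible_extend : forall s x k, admissible s ->
  exists y, admissible (y :: s) /\
    ef k (env_cons y (seq_env s)) = ef k (env_cons x (seq_env s)).

Definition realizes k (s s' : seq L) := forall x, exists2 y, y \in s' &
  ef k (env_cons x (seq_env s)) = ef k (env_cons y (seq_env s)).

Lemma admissible_realizes k s : admissible s ->
  exists s', [/\ admissible s', {subset s <= s'} & realizes k s s'].
Proof.
move=> s_adm; pose e x := ef k (env_cons x (seq_env s)).
suff: forall ts : seq (ef_type k (size s).+1), exists s',
    [/\ admissible s', {subset s <= s'} &
      forall x, e x \in ts -> exists2 y, y \in s' & e x = e y].
  move=> /(_ (enum (ef_type k (size s).+1)))[s' [s'_adm ss' s'P]].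
  by exists s'; split=> // x; apply: s'P; rewrite mem_enum.
elim=> [|t ts [s' [s'_adm ss' s'P]]]; first by exists s; split.
have [[x xt]|nt] := pselect (exists x, e x = t); last first.
  exists s'; split=> // x; rewrite inE => /predU1P[xt|]; last exact: s'P.
  by case: nt; exists x.
have [y [y_adm yE]] := admissible_extend x k s'_adm.
exists (y :: s'); split=> // [z zs|z]; first by rewrite inE ss' ?orbT.
rewrite inE => /predU1P[zt|/s'P[w ws' ->]]; last first.
  by exists w; rewrite // inE ws' orbT.
exists y; rewrite ?inE ?eqxx // zt -xt /e.
have [i|r ->] := @seq_env_reindex _ _ (seq_env s) s'.
  by apply/ss'/mem_tnth.
by rewrite (env_cons_reindex r x) (env_cons_reindex r y); apply: ef_eq_reindex.
Qed.

Lemma downward_lowenheim_skolem (s0 : seq L) : admissible s0 ->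
  exists P : pred L, [/\ countable [set` P], {subset s0 <= P},
    forall n (v : 'I_n -> suborder P),
      exists2 s, admissible s & forall i, val (v i) \in s &
    elementary (val : suborder P -> L)].
Proof.
move=> s0_adm; have [|k s /(admissible_realizes k)//|f [f0 f_adm f_mono fW]] :=
  @increasing_chain _ admissible realizes s0; first exact: s0_adm.
pose P x := `[< exists n, x \in f n >].
have common n (v : 'I_n -> suborder P) k : exists2 N, k <= N &
    forall i, val (v i) \in f N.
  have /choice[N NP] i : exists N, val (v i) \in f N.
    by apply/asboolP/(valP (v i)).
  exists (maxn k (\max_i N i)) => [|i]; first exact: leq_maxl.
  by apply: f_mono (NP i); rewrite leq_max leq_bigmax orbT.
exists P; split=> [|x xs0|n v|].
- have -> : [set` P]%classic = (\bigcup_n [set` f n])%classic.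
    apply/seteqP; split=> x /=; first by move=> /asboolP[n xn]; exists n.
    by move=> [n _ xn]; apply/asboolP; exists n.
  by apply: bigcup_countable => // n _; exact: finite_set_countable.
- by apply/asboolP; exists 0; rewrite f0.
- by have [N _ vN] := common n v 0; exists (f N).
apply: tarski_vaught_test => [|k n v x]; first exact: Order.le_val.
have [N kN vN] := common n v k.
have [y yN xy] := fW N x; have Py : P y by apply/asboolP; exists N.+1.
exists (Sub y Py); rewrite SubK.
have [r ->] := seq_env_reindex (v := val \o v) vN.
rewrite (env_cons_reindex r x) (env_cons_reindex r y); apply: ef_eq_reindex.
exact: ef_eq_leq kN xy.
Qed.

End DownwardLowenheimSkolem.

Section Ultrapower.
Context {d : Order.disp_t} (L : orderType d) (I : Type).
Variable U : set_system I.
Context {U_ultra : UltraFilter U}.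

Lemma ultra_limit (T : finType) (f : I -> T) :
  exists t, U [set i | f i = t]%classic.
Proof.
apply: contrapT => /forallNP nf.
have /filter_ex[i /(_ (f i))//] : U [set i | forall t, f i <> t]%classic.
apply: filter_forall => t.
by have [/nf//|] := in_ultra_setVsetC [set i | f i = t]%classic U_ultra.
Qed.

Definition ultra_le : rel (I -> L) :=
  fun f g => `[< U [set i | (f i <= g i)%O]%classic >].

Lemma ultra_le_trans : transitive ultra_le.
Proof.
move=> g f h /asboolP fg /asboolP gh; apply/asboolP.
by apply: filterS2 fg gh => i; exact: le_trans.
Qed.

Lemma ultra_le_total : total ultra_le.
Proof.
move=> f g; apply/orP.
have [fg|fg] := in_ultra_setVsetC [set i | (f i <= g i)%O]%classic U_ultra.
  by left; apply/asboolP.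
right; apply/asboolP; apply: filterS fg => i /= /negP.
by rewrite -ltNge => /ltW.
Qed.

Variables (d' : Order.disp_t) (M : orderType d') (pi : (I -> L) -> M).
Hypothesis pi_le : forall f g, (pi f <= pi g)%O = ultra_le f g.
Hypothesis pi_surj : forall m, exists f, pi f = m.

Lemma los_diagram n (v : 'I_n -> I -> L) :
  U [set i | order_diagram (v ^~ i) = order_diagram (pi \o v)]%classic.
Proof.
suff: U [set i | forall p : 'I_n * 'I_n,
    (v p.1 i <= v p.2 i)%O = (pi (v p.1) <= pi (v p.2))%O]%classic.
  by apply: filterS => i vi; apply/order_diagramP => a b; exact: (vi (a, b)).
apply: filter_forall => -[a b] /=; rewrite pi_le /ultra_le.
case: asboolP => [|nab]; first by apply: filterS => i ->.
have [//|] := in_ultra_setVsetC [set i | (v a i <= v b i)%O]%classic U_ultra.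
by apply: filterS => i /= /negP/negbTE.
Qed.

Lemma los k n (v : 'I_n -> I -> L) :
  U [set i | ef k (v ^~ i) = ef k (pi \o v)]%classic.
Proof.
elim: k n v => [|k IHk] n v; first exact: los_diagram.
have cons_at x i : env_cons (x i) (v ^~ i) = (env_cons x v)^~ i.
  by apply/funext; apply: ord_lift0P => [|j]; rewrite !env_consE.
have [t Ut] := ultra_limit (fun i => ef k.+1 (v ^~ i)).
apply: filterS (filterI Ut (los_diagram v)) => i [it di].
apply/ef_succP; split=> // [x|m].
- have /choice[f fP] j : exists y, ef k.+1 (v ^~ j) = t ->
      ef k (env_cons x (v ^~ i)) = ef k (env_cons y (v ^~ j)).
    have [jt|] := pselect (ef k.+1 (v ^~ j) = t); last by exists x.
    have /ef_succP[_ forth _] := etrans it (esym jt).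
    by have [y xy] := forth x; exists y.
  have [j [jt jf]] := filter_ex (filterI Ut (IHk _ (env_cons f v))).
  by exists (pi f); rewrite (fP j jt) cons_at jf env_cons_comp.
- have [f <-] := pi_surj m.
  have [j [jt jf]] := filter_ex (filterI Ut (IHk _ (env_cons f v))).
  have /ef_succP[_ _ back] := etrans it (esym jt); have [x xf] := back (f j).
  by exists x; rewrite xf cons_at jf env_cons_comp.
Qed.

End Ultrapower.

(** * The Ryll-Nardzewski theorem *)

Lemma countable_env (T : Type) n :
  countable [set: T] -> countable [set: 'I_n -> T].
Proof.
move=> /countable_injP[f f_inj]; apply/countable_injP.
exists (fun v => pickle [ffun i => f (v i)]).
move=> v w _ _ /(pcan_inj pickleK)/ffunP vw; apply/funext => i.
by apply: f_inj; rewrite ?inE //; have := vw i; rewrite !ffunE.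
Qed.

Definition pair_coloring d (L : orderType d) (G : set (order_aut L)) (T : Type)
    (c : L -> L -> T) :=
  forall x y x' y', c x y = c x' y' -> exists g, [/\ G g, g x = x' & g y = y'].

Section CountablyCategorical.
Context {d : Order.disp_t} (L : orderType d).
Hypothesis L_cat : countably_categorical L.

Lemma categorical_embedding d' (M : orderType d') (admissible : seq M -> Prop)
    (s0 : seq M) :
  same_type (@env_nil M) (@env_nil L) -> admissible s0 ->
  (forall s x k, admissible s -> exists y, admissible (y :: s) /\
    ef k (env_cons y (seq_env s)) = ef k (env_cons x (seq_env s))) ->
  exists h : L -> M, [/\ elementary h,
    forall n (v : 'I_n -> L),
      exists2 s, admissible s & forall i, h (v i) \in s &
    forall x, x \in s0 -> exists m, h m = x].
Proof.
move=> ML s0_admissible extend.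
have [P [P_countable s0P P_admissible P_elem]] :=
  downward_lowenheim_skolem extend s0_admissible.
have [|f [[g fK gK] f_mono]] :=
    L_cat.2 _ (suborder P) (suborder_countable P_countable).
  apply: ef_elementarily_equivalent => k.
  by rewrite -ML -P_elem; congr (ef k _); exact: env0_eq.
have g_mono : {mono g : x y / (x <= y)%O} by move=> x y; rewrite -f_mono !gK.
exists (val \o g); split=> [n v k|n v|x /s0P Px].
- by rewrite -compA P_elem iso_elementary //; exists f.
- by have [s s_admissible sP] := P_admissible n (g \o v); exists s.
- by exists (f (Sub x Px)); rewrite /= fK.
Qed.

Lemma categorical_accumulation n (vs : nat -> 'I_n -> L) :
  exists v : 'I_n -> L, forall k m, exists2 i, m <= i & ef k v = ef k (vs i).
Proof.
have [U [U_ultra Uoo]] := ultraFilterLemma eventually_filter.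
have [M [pi [pi_le pi_surj]]] :=
  preorder_quotientP (@ultra_le_trans _ L _ U _) (@ultra_le_total _ L _ U _).
have losU := @los _ L _ U U_ultra _ M pi pi_le pi_surj.
pose w (j : 'I_n) : nat -> L := fun i => vs i j.
have [k|//|s x k _|h [hE _ h_onto]] :=
    @categorical_embedding _ M (fun=> True) (codom (pi \o w)).
- have [i iE] := filter_ex (losU k 0 (@env_nil _)).
  rewrite (env0_eq (@env_nil M) (pi \o @env_nil _)) -iE.
  by congr (ef k _); exact: env0_eq.
- by exists x.
have /choice[v vP] j : exists x, h x = pi (w j).
  by apply: h_onto; exact: codom_f.
exists v => k m; have Um : U [set i | m <= i]%classic by apply: Uoo; exists m.
have [i [mi ik]] := filter_ex (filterI Um (losU k n w)).
exists i => //; rewrite -hE; transitivity (ef k (pi \o w)); last exact/esym.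
by congr (ef k _); apply/funext => j; exact: vP.
Qed.

Definition isolated_type n (v : 'I_n -> L) :=
  exists k, forall w : 'I_n -> L, ef k w = ef k v -> same_type w v.

Lemma isolated_type_same n (v w : 'I_n -> L) :
  same_type w v -> isolated_type v -> isolated_type w.
Proof.
move=> wv [k kP]; exists k => u uw j; rewrite wv; apply: kP.
by rewrite uw wv.
Qed.

Lemma not_isolated_avoid n (v t : 'I_n -> L) k : ~ isolated_type v ->
  exists (w : 'I_n -> L) l, [/\ k <= l, ef k w = ef k v & ef l t <> ef l w].
Proof.
move=> nv; have [w [j [wv wvj]]] : exists (w : 'I_n -> L) j,
    ef k w = ef k v /\ ef j w <> ef j v.
  apply: contrapT => nw; apply: nv; exists k => w wv j.
  by apply: contrapT => wvj; apply: nw; exists w, j.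
have [tv|tv] := eqVneq (ef (maxn k j) t) (ef (maxn k j) v).
  exists w, (maxn k j); split=> // [|tw]; first exact: leq_maxl.
  by apply: wvj; apply: ef_eq_leq (leq_maxr k j) _; rewrite -tw.
by exists v, (maxn k j); split=> //; [exact: leq_maxl|exact/eqP].
Qed.

(* Otherwise the type of v can be refined step by step, so as to avoid the i-th
   tuple of L at step i; a tuple of L realizing the limit would avoid itself. *)
Lemma isolated_dense n (v : 'I_n -> L) k :
  exists2 w : 'I_n -> L, isolated_type w & ef k w = ef k v.
Proof.
apply: contrapT => nw.
have /countable_injP[rank rank_inj] := countable_env n L_cat.1.
pose isolation_free (p : ('I_n -> L) * nat) :=
  forall w, ef p.2 w = ef p.2 p.1 -> ~ isolated_type w.
pose refines (p q : ('I_n -> L) * nat) := p.2 <= q.2 /\ ef p.2 q.1 = ef p.2 p.1.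
pose step i p q :=
  refines p q /\ forall t, rank t = i -> ef q.2 t <> ef q.2 q.1.
have [w wv iw|i [u l] ul|f [_ _ f_step]] :=
  @dependent_choice_from _ isolation_free step (v, k).
- by apply: nw; exists w.
- have refines_free q : refines (u, l) q -> isolation_free q.
    by move=> [lq uq] w /(ef_eq_leq lq) wq; apply: ul; rewrite wq.
  have [[t ti]|ni] := pselect (exists t, rank t = i); last first.
    by exists (u, l) => //; split=> // t ti; case: ni; exists t.
  have [w [m [lm wu tw]]] := not_isolated_avoid t l (ul u erefl).
  exists (w, m); first exact: refines_free.
  by split=> // t' t'i; rewrite (rank_inj t' t) ?inE // ti.
have f_refines : {homo f : i j / i <= j >-> refines i j}.
  apply: homo_leq => [//|q p r [pq qp] [qr rq]|i]; last exact: (f_step i).1.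
  by split; [exact: leq_trans qr|rewrite -qp; exact: ef_eq_leq rq].
have [w wP] := categorical_accumulation (fun i => (f i).1).
have [i wi fi] := wP (f (rank w).+1).2 (rank w).+1.
have [_ wf] := f_refines _ _ wi.
by apply: (f_step (rank w)).2 _ erefl _; rewrite fi.
Qed.

Lemma isolated_extend n (v : 'I_n -> L) x k : isolated_type v ->
  exists y, isolated_type (env_cons y v) /\
    ef k (env_cons y v) = ef k (env_cons x v).
Proof.
move=> [l lP]; have [w w_iso wx] := isolated_dense (env_cons x v) (maxn k l).
have wv : same_type (w \o lift ord0) v.
  apply: lP; have -> : v = env_cons x v \o lift ord0.
    by apply/funext => i; rewrite /= env_cons_lift.
  by apply: ef_eq_reindex; apply: ef_eq_leq wx; exact: leq_maxr.
have [m mP] := w_iso; have /ef_succP[_ forth _] := wv (maxn k m).+1.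
have [y] := forth (w ord0); rewrite env_cons_eta => wy; exists y; split.
  apply: isolated_type_same w_iso; apply: mP; apply/esym.
  by apply: ef_eq_leq wy; exact: leq_maxr.
transitivity (ef k w); last by apply: ef_eq_leq wx; exact: leq_maxl.
by apply/esym; apply: ef_eq_leq wy; exact: leq_maxl.
Qed.

Lemma isolated_reindex m n (r : 'I_n -> 'I_m) (v : 'I_m -> L) :
  isolated_type v -> isolated_type (v \o r).
Proof.
move=> [k kP]; exists (k + m) => w /esym vw.
have [N [v' [w' [a [b [vw' vE vrE wE]]]]]] := ef_eq_extend v vw.
have wv : same_type (w' \o a) v.
  by apply: kP; rewrite vE; apply/esym/ef_eq_reindex.
suff -> : w = w' \o a \o r by move=> j; apply: ef_eq_reindex; exact: wv.
have /order_diagramP vw0 := ef_diagram vw'.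
apply/funext => i; rewrite wE /=; apply/le_anti; rewrite -!vw0.
have -> : v' (a (r i)) = v' (b i).
  by rewrite -[LHS]/((v' \o a) (r i)) -vE -[RHS]/((v' \o b) i) -vrE.
by rewrite lexx.
Qed.

Lemma categorical_isolated n (v : 'I_n -> L) : isolated_type v.
Proof.
have [//||s x k s_iso|h [hE h_iso _]] :=
    @categorical_embedding _ L (fun s => isolated_type (seq_env s)) [::].
- by exists 0 => w _ j; congr (ef j _); exact: env0_eq.
- by have [y] := isolated_extend x k s_iso; exists y; rewrite -seq_env_cons.
have [s s_iso vs] := h_iso _ v.
have [r rE] := seq_env_reindex (v := h \o v) vs.
apply: (isolated_type_same (v := h \o v)) => [k|]; first by rewrite hE.
by rewrite rE; exact: isolated_reindex.
Qed.

Lemma categorical_rank n :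
  exists k, forall v w : 'I_n -> L, ef k v = ef k w -> same_type v w.
Proof.
apply: contrapT => /forallNP nk.
pose separating k (v : 'I_n -> L) :=
  ~ forall w : 'I_n -> L, ef k w = ef k v -> same_type w v.
have /choice[v vP] k : exists v, separating k v.
  apply: contrapT => /forallNP nv; apply: (nk k) => w v wv.
  by have /contrapT := nv v; apply.
have [u uP] := categorical_accumulation v.
have [k kP] := categorical_isolated u; have [i ki ui] := uP k k.
have vu : same_type (v i) u by apply: kP.
apply: (vP i) => w wv j; rewrite vu; apply: kP; rewrite ui.
exact: ef_eq_leq wv.
Qed.

Lemma same_type_forth n (v w : 'I_n -> L) x : same_type v w ->
  exists y, same_type (env_cons x v) (env_cons y w).
Proof.
move=> vw; have [k kP] := categorical_rank n.+1.
have /ef_succP[_ forth _] := vw k.+1; have [y xy] := forth x.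
by exists y; exact: kP.
Qed.

Lemma same_type_aut n (v w : 'I_n -> L) : same_type v w ->
  exists g : order_aut L, forall i, g (v i) = w i.
Proof.
move=> vw; pose P (s : seq (L * L)) :=
  same_type (fst \o seq_env s) (snd \o seq_env s).
pose s0 := codom (fun i => (v i, w i)).
have [|s x|s y|s ss' p q|g [gE _]] := @back_and_forth _ L P s0 L_cat.1.
- have /choice[r rE] j : exists i, seq_env s0 j = (v i, w i).
    by have /codomP[i] := mem_tnth j (in_tuple s0); exists i.
  move=> k; rewrite (_ : fst \o _ = v \o r); last first.
    by apply/funext => j; rewrite /= rE.
  rewrite (_ : snd \o _ = w \o r); last by apply/funext => j; rewrite /= rE.
  exact: ef_eq_reindex.
- move=> /(same_type_forth x)[y xy]; exists y.
  by rewrite /P -seq_env_cons !env_cons_comp.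
- move=> ss'; have /(same_type_forth y)[x yx] :
      same_type (snd \o seq_env s) (fst \o seq_env s).
    by move=> k; exact/esym.
  by exists x => k; rewrite -seq_env_cons !env_cons_comp; exact/esym.
- move=> /(tnthP (in_tuple s))[i ->] /(tnthP (in_tuple s))[j ->].
  by have /order_diagramP := ss' 0; apply.
exists g => i; apply: (gE (v i, w i)).
exact: codom_f (fun i => (v i, w i)) i.
Qed.

Lemma categorical_pair_coloring :
  exists n (c : L -> L -> 'I_n), pair_coloring [set: order_aut L]%classic c.
Proof.
have [k kP] := categorical_rank 2.
pose pair x y : 'I_2 -> L := env_cons x (env_cons y (@env_nil L)).
exists #|ef_type k 2|, (fun x y => enum_rank (ef k (pair x y))) => x y x' y'.
move=> /enum_rank_inj/kP/same_type_aut[g gE]; exists g.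
by have := gE ord0; have := gE (lift ord0 ord0); rewrite /pair !env_consE.
Qed.

End CountablyCategorical.

(** * Ramsey's theorem *)

Lemma sorted_subset_subseq d (T : porderType d) (s t : seq T) :
  sorted <%O s -> sorted <%O t -> {subset s <= t} -> subseq s t.
Proof.
move=> ss st st_sub.
suff -> : s = [seq x <- t | x \in s] by exact: filter_subseq.
apply: lt_sorted_eq => // [|x]; first exact: lt_sorted_filter.
by rewrite mem_filter; case: (boolP (x \in s)) => // /st_sub.
Qed.

Section FiniteRamsey.
Variables (T : finType) (c : seq nat -> T) (n : nat).
Variables (U : set_system nat) (lim : (nat -> T) -> T).
Context {U_ultra : UltraFilter U}.
Hypothesis U_free : forall m, U [set k | m <= k]%classic.
Hypothesis limP : forall f, U [set k | f k = lim f]%classic.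

(* The lists of naturals are decreasing: they grow at the head. *)
Fixpoint iterated_limit e (s : seq nat) : T :=
  if e is e'.+1 then lim (fun k => iterated_limit e' (k :: s)) else c (rev s).

Definition coherent (ks : seq nat) := forall s e,
  subseq s ks -> size s + e = n -> iterated_limit e s = iterated_limit n [::].

Lemma coherent_cons ks : coherent ks -> U [set k | coherent (k :: ks)]%classic.
Proof.
move=> ksP.
have: U [set k | forall b : (size ks).-tuple bool, forall e : 'I_n,
    size (mask b ks) + e.+1 = n ->
    iterated_limit e (k :: mask b ks) = iterated_limit n [::]]%classic.
  apply: filter_forall => b; apply: filter_forall => e.
  have [sz|nsz] := pselect (size (mask b ks) + e.+1 = n); last first.
    by apply: filterS filterT => k _ /nsz.
  apply: filterS (limP (fun k => iterated_limit e (k :: mask b ks))).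
  by move=> k /= -> _; apply: (ksP (mask b ks) e.+1) => //; exact: mask_subseq.
apply: filterS => k kP [|x s] e; first by move=> _ <-.
rewrite [subseq _ _]/=; case: eqP => [->|_]; last exact: ksP.
move=> /subseqP[b /eqP sz_b ->]; rewrite addSnnS => sz.
have en : e < n by rewrite -sz leq_addl.
exact: (kP (Tuple sz_b) (Ordinal en) sz).
Qed.

Lemma coherent_exists m :
  exists ks, [/\ size ks = m, sorted gtn ks & coherent ks].
Proof.
elim: m => [|m [ks [sz_ks ks_sorted ks_coherent]]].
  by exists [::]; split=> // s e; rewrite subseq0 => /eqP -> /= <-.
have [k [k_coherent k_gt]] := filter_ex
  (filterI (coherent_cons ks_coherent) (U_free (head 0 ks).+1)).
exists (k :: ks); split=> //=; first by rewrite sz_ks.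
by case: (ks) k_gt ks_sorted => //= x s ->.
Qed.

End FiniteRamsey.

Lemma finite_ramsey (T : finType) (c : seq nat -> T) n m :
  exists (ks : seq nat) (t : T), [/\ size ks = m, sorted ltn ks &
    forall s, sorted ltn s -> {subset s <= ks} -> size s = n -> c s = t].
Proof.
have [U [U_ultra Uoo]] := ultraFilterLemma eventually_filter.
have U_free k : U [set i | k <= i]%classic by apply: Uoo; exists k.
have /choice[lim limP] (f : nat -> T) : exists t, U [set i | f i = t]%classic.
  exact: ultra_limit.
have [ks [sz_ks ks_sorted ks_coherent]] := coherent_exists c n U_free limP m.
exists (rev ks), (iterated_limit c lim n [::]); rewrite size_rev rev_sorted.
split=> // s s_sorted s_ks sz_s; rewrite -[s]revK.
apply: (ks_coherent (rev s) 0); last by rewrite size_rev addn0.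
rewrite -subseq_rev revK; apply: sorted_subset_subseq => //.
by rewrite rev_sorted.
Qed.

(** * Coloured dense orders *)

Lemma seq_max d (L : orderType d) x (s : seq L) :
  exists2 m, m \in x :: s & {in x :: s, forall y, (y <= m)%O}.
Proof.
elim: s x => [|y s IHs] x.
  by exists x => [|y]; rewrite inE // => /eqP->.
have [m m_s m_max] := IHs y; have [xm|/ltW mx] := leP x m.
  exists m; first by rewrite inE m_s orbT.
  by move=> z; rewrite inE => /predU1P[->//|/m_max].
exists x; first by rewrite inE eqxx.
by move=> z; rewrite inE => /predU1P[->//|/m_max zm]; exact: le_trans zm mx.
Qed.

Lemma seq_min d (L : orderType d) x (s : seq L) :
  exists2 m, m \in x :: s & {in x :: s, forall y, (m <= y)%O}.
Proof. exact: (@seq_max _ (L^d)%O). Qed.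

Lemma index_lt d (L : orderType d) (s : seq L) x y :
  sorted <%O s -> x \in s -> y \in s -> (x < y)%O -> index x s < index y s.
Proof.
rewrite lt_sorted_uniq_le => /andP[_ s_sorted] xs ys; rewrite ltNge ltnNge.
by apply: contra => /(sorted_leq_index le_trans lexx s_sorted y x ys xs).
Qed.

Section ColoredOrder.
Context {d : Order.disp_t} {Q : orderType d} {K : Type} (col : Q -> K).
Implicit Types (q z : Q) (h : order_aut Q).

Record dense_coloring : Prop := DenseColoring {
  color_above : forall a q, exists2 z, col z = col q & (a < z)%O;
  color_below : forall b q, exists2 z, col z = col q & (z < b)%O;
  color_between : forall a b q, (a < b)%O ->
    exists2 z, col z = col q & (a < z < b)%O
}.

Definition color_preserving h := forall q, col (h q) = col q.

Hypothesis col_dense : dense_coloring.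

Lemma color_insert (lo hi : seq Q) q : {in lo & hi, forall a b, (a < b)%O} ->
  exists z, [/\ col z = col q, {in lo, forall a, (a < z)%O} &
    {in hi, forall b, (z < b)%O}].
Proof.
case: lo => [|a lo]; case: hi => [|b hi] lohi.
- by exists q.
- have [m _ m_min] := seq_min b hi; have [z zq zm] := color_below col_dense m q.
  by exists z; split=> // y /m_min; exact: lt_le_trans.
- have [m _ m_max] := seq_max a lo; have [z zq mz] := color_above col_dense m q.
  by exists z; split=> // y /m_max ym; exact: le_lt_trans mz.
- have [m m_lo m_max] := seq_max a lo; have [m' m_hi m_min] := seq_min b hi.
  have [z zq /andP[mz zm']] := color_between col_dense q (lohi _ _ m_lo m_hi).
  exists z; split=> // y; first by move=> /m_max ym; exact: le_lt_trans mz.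
  by move=> /m_min; exact: lt_le_trans.
Qed.

Definition colored_partial_iso (s : seq (Q * Q)) :=
  {in s, forall p, col p.1 = col p.2} /\
  {in s &, forall p p', (p.1 <= p'.1)%O = (p.2 <= p'.2)%O}.

Lemma colored_partial_iso_sub (s s' : seq (Q * Q)) :
  {subset s <= s'} -> colored_partial_iso s' -> colored_partial_iso s.
Proof.
move=> ss' [s'_col s'_mono]; split=> [p ps|p p' ps ps'].
  by apply: s'_col; exact: ss'.
by apply: s'_mono; exact: ss'.
Qed.

Lemma colored_partial_iso_swap (s : seq (Q * Q)) :
  colored_partial_iso s -> colored_partial_iso [seq (p.2, p.1) | p <- s].
Proof.
move=> [s_col s_mono]; split=> [_ /mapP[p ps ->]|]; first exact/esym/s_col.
by move=> _ _ /mapP[p ps ->] /mapP[p' ps' ->]; exact/esym/s_mono.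
Qed.

Lemma colored_partial_iso_forth (s : seq (Q * Q)) x : colored_partial_iso s ->
  exists y, colored_partial_iso ((x, y) :: s).
Proof.
move=> s_iso; have [/mapP[[x' y] ys ->]|xs] := boolP (x \in unzip1 s).
  exists y; apply: colored_partial_iso_sub s_iso => p.
  by rewrite inE => /predU1P[->|].
have [s_col s_mono] := s_iso.
have s_lt : {in s &, forall p p', (p.1 < p'.1)%O = (p.2 < p'.2)%O}.
  by move=> p p' ps ps'; rewrite !ltNge s_mono.
have x_s p : p \in s -> (x < p.1)%O = (x <= p.1)%O.
  by move=> ps; rewrite lt_neqAle; case: eqP => // xp; rewrite xp map_f in xs.
have [|y [y_col lo_y y_hi]] := @color_insert
    [seq p.2 | p <- s & (p.1 < x)%O] [seq p.2 | p <- s & (x < p.1)%O] x.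
  move=> _ _ /mapP[p + ->] /mapP[p' + ->]; rewrite !mem_filter.
  by move=> /andP[px ps] /andP[xp' ps']; rewrite -s_lt //; exact: lt_trans xp'.
have xy_le p : p \in s ->
    (x <= p.1)%O = (y <= p.2)%O /\ (p.1 <= x)%O = (p.2 <= y)%O.
  move=> ps; rewrite -x_s // [(_ <= x)%O]leNgt; have [xp|px] := ltP x p.1.
    have yp : (y < p.2)%O by apply: y_hi; apply: map_f; rewrite mem_filter xp.
    by rewrite (ltW yp) leNgt yp.
  have {}px : (p.1 < x)%O by rewrite ltNge -x_s // -leNgt.
  have py : (p.2 < y)%O by apply: lo_y; apply: map_f; rewrite mem_filter px.
  by rewrite (ltW py) leNgt py.
exists y; split=> [p|p p']; rewrite !inE.
  by move=> /predU1P[->//|/s_col].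
move=> /predU1P[->|ps] /predU1P[->|ps'] /=; first by rewrite !lexx.
- exact: (xy_le _ ps').1.
- exact: (xy_le _ ps).2.
- exact: s_mono.
Qed.

Lemma colored_homogeneous (s : seq (Q * Q)) : countable [set: Q] ->
  colored_partial_iso s ->
  exists2 h, color_preserving h & {in s, forall p, h p.1 = p.2}.
Proof.
move=> Q_countable s_iso; have [|t x|t y|t [_ ]|h [hs hP]] :=
  @back_and_forth _ Q colored_partial_iso s Q_countable.
- exact: s_iso.
- exact: colored_partial_iso_forth.
- move=> /colored_partial_iso_swap/(colored_partial_iso_forth y)[x].
  move=> /colored_partial_iso_swap; rewrite /= -map_comp map_id_in => [|[]] //.
  by exists x.
- by [].
exists h => // q; have [t [t_col _] qt] := hP q.
exact/esym/(t_col (q, h q)).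
Qed.

Definition increasing_blocks (Z : seq Q) (Y : nat -> K -> Q) :=
  (forall k q, col (Y k (col q)) = col q) /\
  forall k k', k < k' ->
    {in Z &, forall z z', (Y k (col z) < Y k' (col z'))%O}.

Lemma increasing_blocks_exist (Z : seq Q) (q0 : Q) :
  exists Y, increasing_blocks Z Y.
Proof.
have /choice[up upP] (p : Q * K) :
    exists z, forall q, col q = p.2 -> col z = p.2 /\ (p.1 < z)%O.
  have [[q <-]|np] := pselect (exists q, col q = p.2); last first.
    by exists q0 => q qp; case: np; exists q.
  by have [z zq pz] := color_above col_dense p.1 q; exists z.
pose b := fix b k :=
  if k is k'.+1 then \big[Order.max/b k']_(z <- Z) up (b k', col z) else q0.
have b_mono : {homo b : k k' / k <= k' >-> (k <= k')%O}.
  by apply: homo_leq => // [? ? ?|k]; [exact: le_trans|exact: bigmax_ge_id].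
exists (fun k c => up (b k, c)); split=> [k q|k k' kk' z z' zZ z'Z].
  by have [] := upP (b k, col q) q erefl.
apply: (@le_lt_trans _ _ (b k')); last first.
  by have [] := upP (b k', col z') z' erefl.
by apply: le_trans (b_mono _ _ kk') => /=; exact: le_bigmax_seq.
Qed.

Lemma increasing_blocks_place (Z : seq Q) Y (w : seq Q) (ks : seq nat) :
  countable [set: Q] -> increasing_blocks Z Y ->
  sorted <%O w -> {subset w <= Z} -> sorted ltn ks -> size ks = size w ->
  exists2 h, color_preserving h &
    {in w, forall q, h q = Y (nth 0 ks (index q w)) (col q)}.
Proof.
move=> Q_countable [Y_col Y_lt] w_sorted wZ ks_sorted sz_ks.
pose p q := (q, Y (nth 0 ks (index q w)) (col q)).
have [|h h_col hP] := @colored_homogeneous (map p w) Q_countable; last first.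
  by exists h => // q qw; apply: (hP (p q)); exact: map_f.
have p_lt : {in w &, forall q q', (q < q')%O -> ((p q).2 < (p q').2)%O}.
  move=> q q' qw qw' qq'; apply: Y_lt; [|exact: wZ|exact: wZ].
  apply: (sorted_ltn_nth ltn_trans) => //; first by rewrite inE sz_ks index_mem.
    by rewrite inE sz_ks index_mem.
  exact: index_lt.
split=> [_ /mapP[q qw ->]|_ _ /mapP[q qw ->] /mapP[q' qw' ->]] /=.
  exact/esym/Y_col.
by have [/p_lt-/(_ qw qw')/ltW->|/p_lt-/(_ qw' qw)/lt_geF->|->] := ltgtP q q';
  rewrite ?lexx.
Qed.

Definition block_positions (Z : seq Q) (ks : seq nat) h (w : seq Q) :=
  [seq nth 0 ks (index (h q) Z) | q <- w].

Lemma block_positions_sorted (Z : seq Q) (ks : seq nat) h (w : seq Q) :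
  sorted <%O Z -> sorted ltn ks -> size ks = size Z -> sorted <%O w ->
  {in w, forall q, h q \in Z} -> sorted ltn (block_positions Z ks h w).
Proof.
move=> Z_sorted ks_sorted sz_ks w_sorted hZ; rewrite sorted_map.
apply: (@sub_in_sorted _ (mem w) <%O) w_sorted; last exact/allP.
move=> q q' qw qw' qq'; apply: (sorted_ltn_nth ltn_trans) => //.
- by rewrite inE sz_ks index_mem hZ.
- by rewrite inE sz_ks index_mem hZ.
- by apply: index_lt; rewrite ?hZ ?aut_lt.
Qed.

Lemma colored_ramsey_sorted (T : finType) (chi : order_aut Q -> T) (w : seq Q)
    (F : seq (order_aut Q)) (q0 : Q) :
  countable [set: Q] -> sorted <%O w ->
  (forall h h', color_preserving h -> color_preserving h' ->
    {in w, h =1 h'} -> chi h = chi h') ->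
  {in F, forall f, color_preserving f} ->
  exists t, exists2 h, color_preserving h & {in F, forall f, chi (h * f)%g = t}.
Proof.
move=> Q_countable w_sorted chi_w F_col.
pose Z := sort <=%O (undup [seq f q | f : order_aut Q <- 1%g :: F, q <- w]).
have Z_sorted : sorted <%O Z by rewrite sort_lt_sorted undup_uniq.
have mem_Z (f : order_aut Q) q : f \in 1%g :: F -> q \in w -> f q \in Z.
  by move=> fF qw; rewrite mem_sort mem_undup; apply/allpairsP; exists (f, q).
have [Y Y_blocks] := increasing_blocks_exist Z q0.
have /choice[place placeP] (s : seq nat) : exists h,
    sorted ltn s -> size s = size w -> color_preserving h /\
      {in w, forall q, h q = Y (nth 0 s (index q w)) (col q)}.
  have [[s_sorted sz_s]|ns] := pselect (sorted ltn s /\ size s = size w).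
    have [|h h_col hP] := increasing_blocks_place Q_countable Y_blocks w_sorted
      _ s_sorted sz_s; last by exists h.
    by move=> q; apply: (mem_Z 1%g); rewrite inE eqxx.
  by exists 1%g => s_sorted sz_s; case: ns.
have [ks [t [sz_ks ks_sorted ksP]]] :=
  finite_ramsey (chi \o place) (size w) (size Z).
have [//|h h_col hP] :=
  increasing_blocks_place Q_countable Y_blocks Z_sorted _ ks_sorted sz_ks.
exists t, h => // f fF; have {}mem_Z q : q \in w -> f q \in Z.
  by apply: mem_Z; rewrite inE fF orbT.
pose s := block_positions Z ks f w.
have s_sorted : sorted ltn s by exact: block_positions_sorted.
have [place_col place_s] := placeP s s_sorted (size_map _ _).
rewrite -(ksP s) ?size_map //; last first.
  by move=> _ /mapP[q qw ->]; rewrite mem_nth // sz_ks index_mem mem_Z.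
apply: chi_w => // q => [|qw]; first by rewrite h_col F_col.
rewrite autME hP ?mem_Z // F_col // place_s //.
by rewrite (nth_map q0) ?index_mem // nth_index.
Qed.

Lemma colored_ramsey (T : finType) (chi : order_aut Q -> T) (u : seq Q)
    (F : seq (order_aut Q)) :
  countable [set: Q] ->
  (forall h h', color_preserving h -> color_preserving h' ->
    {in u, h =1 h'} -> chi h = chi h') ->
  {in F, forall f, color_preserving f} ->
  exists2 h, color_preserving h & {in F, forall f, chi (h * f)%g = chi h}.
Proof.
move=> Q_countable chi_u F_col.
have one_col : color_preserving 1%g by [].
have [u0|[q0 _]] : u = [::] \/ exists q, q \in u.
  by case: (u) => [|q s]; [left|right; exists q; rewrite inE eqxx].
  exists 1%g => // f fF; rewrite mul1g; apply: chi_u => //; first exact: F_col.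
  by rewrite u0.
pose w := sort <=%O (undup u).
have [|h h' h_col h'_col hh'|f|t [h h_col ht]] :=
    @colored_ramsey_sorted _ chi w (1%g :: F) q0 Q_countable.
- by rewrite sort_lt_sorted undup_uniq.
- by apply: chi_u => // q qu; apply: hh'; rewrite mem_sort mem_undup.
- by rewrite inE => /predU1P[->//|/F_col].
exists h => // f fF; rewrite ht ?inE ?fF ?orbT // -[h in RHS]mulg1.
by rewrite ht // inE eqxx.
Qed.

End ColoredOrder.

(** * Primitive groups of automorphisms *)

Definition is_subgroup (G : groupType) (H : set G) :=
  [/\ H 1%g, forall g h, H g -> H h -> H (g * h)%g &
    forall g, H g -> H (g^-1)%g].

Lemma nat_pigeonhole (T : finType) (f : nat -> T) :
  exists i j, i < j /\ f i = f j.
Proof.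
have /injectivePn[i [j nij fij]] : ~~ injectiveb (fun i : 'I_#|T|.+1 => f i).
  by apply/negP => /injectiveP/leq_card; rewrite card_ord ltnn.
case: (ltngtP i j) => [ij|ji|/val_inj ij]; first by exists i, j.
  by exists j, i.
by rewrite ij eqxx in nij.
Qed.

Section AutomorphismGroup.
Context {d : Order.disp_t} {L : orderType d} (G : set (order_aut L)).
Implicit Types (E : L -> L -> Prop) (I : set L) (g h : order_aut L).

Record convex_congruence E : Prop := ConvexCongruence {
  congruence_refl : forall x, E x x;
  congruence_sym : forall x y, E x y -> E y x;
  congruence_trans : forall y x z, E x y -> E y z -> E x z;
  congruence_convex : forall x y z, E x z -> (x <= y)%O -> (y <= z)%O -> E x y;
  congruence_aut : forall g x y, G g -> E x y -> E (g x) (g y)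
}.

Definition primitive := forall E, convex_congruence E ->
  (forall x y, E x y -> x = y) \/ (forall x y, E x y).

Record invariant_cut I : Prop := InvariantCut {
  cut_down : forall x y, I y -> (x <= y)%O -> I x;
  cut_aut : forall g x, G g -> I x -> I (g x);
  cut_nonempty : exists x, I x;
  cut_proper : exists x, ~ I x
}.

Definition aut_orbit x : set L := [set y | exists2 g, G g & g x = y]%classic.

Lemma eq_congruence : convex_congruence eq.
Proof.
split=> // [y x z -> //|x y z <- xy yx|g x y _ -> //].
by apply/le_anti; rewrite xy yx.
Qed.

Hypothesis G_group : is_subgroup G.

Lemma aut_orbit_refl x : aut_orbit x x.
Proof. by have [G1 _ _] := G_group; exists 1%g. Qed.

Lemma aut_orbit_aut g x : G g -> aut_orbit (g x) = aut_orbit x.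
Proof.
move=> Gg; have [_ GM GV] := G_group; apply/seteqP; split=> _ [h Gh <-].
  by exists (h * g)%g; first exact: GM.
by exists (h * g^-1)%g; [exact/GM/GV|rewrite autME autK].
Qed.

Section NoInvariantCut.
Hypothesis no_cut : forall I, ~ invariant_cut I.

Lemma orbit_above (a b z w : L) : (a < b)%O -> exists2 g, G g & (z < g w)%O.
Proof.
move=> ab; apply: contrapT => nz; have [G1 GM GV] := G_group.
pose below_orbit x := exists2 g, G g & (x < g w)%O.
have [below0|nbelow] := pselect (exists x, below_orbit x).
  apply: (no_cut (I := below_orbit)).
  split=> [x y [g Gg yg] xy|h x Gh [g Gg xg]||].
  - by exists g => //; exact: le_lt_trans xy yg.
  - by exists (h * g)%g; [exact: GM|rewrite autME aut_lt].
  - exact: below0.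
  - by exists z.
have w_min g x : G g -> (g w <= x)%O.
  by move=> Gg; rewrite leNgt; apply/negP => xg; apply: nbelow; exists x, g.
apply: (no_cut (I := [set x | x <= w]%O%classic)).
split=> /= [x y yw xy|h x Gh xw||].
- exact: le_trans xy yw.
- by apply: le_trans (w_min h w Gh); rewrite aut_mono.
- by exists w.
- by exists b => bw; have := w_min 1%g a G1; rewrite leNgt (lt_le_trans ab bw).
Qed.

Lemma orbit_below (a b z w : L) : (a < b)%O -> exists2 g, G g & (g w < z)%O.
Proof.
move=> ab; apply: contrapT => nz; have [G1 GM GV] := G_group.
apply: (no_cut (I := [set x | forall g, G g -> (x <= g w)%O]%classic)).
split=> [x y yw xy g Gg|h x Gh xw g Gg||].
- exact: le_trans xy (yw g Gg).
- rewrite -(aut_mono h^-1%g) autK -autME; apply: xw.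
  by apply: GM => //; exact: GV.
- by exists z => g Gg; rewrite leNgt; apply/negP => gz; apply: nz; exists g.
- have [g Gg wg] := orbit_above w w ab; exists (g w) => /(_ 1%g G1).
  by rewrite leNgt wg.
Qed.

Hypothesis G_primitive : primitive.

Lemma interval_meets_orbit (a b w : L) :
  (a < b)%O -> exists2 g, G g & (a <= g w <= b)%O.
Proof.
move=> ab; apply: contrapT => nab; have [G1 GM GV] := G_group.
pose E x y := forall g, G g ->
  (g w < x)%O = (g w < y)%O /\ (g w <= x)%O = (g w <= y)%O.
have E_congruence : convex_congruence E.
  split=> // [x y xy g /xy[-> ->] //|y x z xy yz g Gg|x y z xz xy yz g Gg|].
  - by have [-> ->] := xy g Gg; exact: yz.
  - have [e e'] := xz g Gg; split; apply/idP/idP => gw.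
    + exact: lt_le_trans gw xy.
    + by rewrite e; exact: lt_le_trans gw yz.
    + exact: le_trans gw xy.
    + by rewrite e'; exact: le_trans gw yz.
  - move=> h x y Gh xy g Gg; rewrite !lt_aut_inv !le_aut_inv -autME.
    by apply: xy; apply: GM => //; exact: GV.
have [E_eq|E_total] := G_primitive E_congruence.
  have /E_eq e : E a b; last by rewrite e ltxx in ab.
  move=> g Gg; have [ag|ga] := leP a (g w); last first.
    by rewrite (lt_trans ga ab) (ltW ga) (ltW (lt_trans ga ab)).
  have bg : (b < g w)%O.
    by rewrite ltNge; apply/negP => gb; apply: nab; exists g; rewrite // ag gb.
  have {}ag := lt_trans ab bg.
  by rewrite (lt_gtF bg) (lt_geF ag) (lt_geF bg).
have [g Gg wg] := orbit_above w w ab.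
by have [] := E_total w (g w) 1%g G1; rewrite aut1E ltxx wg.
Qed.

Definition between (x z y : L) := (x <= z <= y)%O || (y <= z <= x)%O.

Lemma between_sym x z y : between x z y = between y z x.
Proof. exact: orbC. Qed.

Lemma between_split y x z w : between x w z -> between x w y || between y w z.
Proof.
rewrite /between => /orP[] /andP[-> ->]; rewrite ?andbT /=;
by case: (leP w y) => [//|/ltW ->]; rewrite !orbT.
Qed.

Lemma between_aut g x z y : between (g x) z (g y) = between x ((g^-1)%g z) y.
Proof. by rewrite -[z in LHS](autVK g) /between !aut_mono. Qed.

Lemma between_right x y : between x y y.
Proof. by rewrite /between lexx andbT andTb le_total. Qed.

Definition same_stabilizer x y := forall z, between x z y ->
  forall g, G g -> g z = z <-> g x = x.

Lemma same_stabilizer_congruence : convex_congruence same_stabilizer.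
Proof.
have [_ GM GV] := G_group; split.
- by move=> x z; rewrite /between orbb => /le_anti->.
- move=> x y xy z; rewrite between_sym => /xy xz g Gg.
  by rewrite xz // xy //; exact: between_right.
- move=> y x z xy yz w /(between_split y)/orP[/xy//|/yz yw] g Gg.
  by rewrite yw // xy //; exact: between_right.
- move=> x y z xz xy yz w /orP[|] /andP[u v].
    by apply: xz; rewrite /between u (le_trans v yz).
  have -> : w = x by apply/le_anti; rewrite v (le_trans xy u).
  by [].
- move=> h x y Gh xy z; rewrite between_aut => /xy zx g Gg.
  have conj t : g t = t <-> (h^-1 * g * h)%g ((h^-1)%g t) = (h^-1)%g t.
    rewrite !autME autVK; split=> [->//|e].
    exact: (can_inj (autK h^-1%g)).
  rewrite conj zx; last exact: GM (GM _ _ (GV _ Gh) Gg) Gh.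
  by rewrite conj autK.
Qed.

Lemma adjacent_same_stabilizer a b :
  (a < b)%O -> (forall z, ~ (a < z < b)%O) -> same_stabilizer a b.
Proof.
move=> ab nab z zab; have [_ _ GV] := G_group.
have {zab} : z = a \/ z = b.
  have {zab}/andP[az zb] : (a <= z <= b)%O.
    case/orP: zab => // /andP[bz za].
    by have := le_trans bz za; rewrite leNgt ab.
  have [->|za] := eqVneq z a; first by left.
  have [->|zb'] := eqVneq z b; first by right.
  by case: (nab z); rewrite !lt_neqAle az zb zb' eq_sym za.
case=> [->//|->] g Gg.
have above h : h a = a -> (b <= h b)%O.
  move=> ha; rewrite leNgt; apply/negP => hb; apply: (nab (h b)).
  by rewrite hb andbT -{1}ha aut_lt.
have below h : h b = b -> (h a <= a)%O.
  move=> hb; rewrite leNgt; apply/negP => ha; apply: (nab (h a)).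
  by rewrite ha -hb aut_lt.
have fixV h x : h x = x -> (h^-1)%g x = x by move=> hx; rewrite -{1}hx autK.
split=> gx; apply/le_anti.
  by rewrite below //= -(aut_mono g^-1%g) autK below //; exact: fixV.
by rewrite above // andbT -(aut_mono g^-1%g) autK above //; exact: fixV.
Qed.

(* Otherwise adjacent points, and hence by primitivity all points, have the same
   stabilizer, but two of the infinitely many points above a lie in the same
   orbit of the stabilizer of a. *)
Lemma primitive_dense (T : finType) (c : L -> L -> T) (a b : L) :
  pair_coloring G c -> (a < b)%O -> exists z, (a < z < b)%O.
Proof.
move=> c_coloring ab; apply: contrapT => /forallNP nab.
have [E_eq|E_total] := G_primitive same_stabilizer_congruence.
  by have /E_eq e := adjacent_same_stabilizer ab nab; rewrite e ltxx in ab.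
have /choice[up up_lt] (x : L) : exists y, (x < y)%O.
  by have [g _ xg] := orbit_above x x ab; exists (g x).
pose y i := iter i up a.
have y_lt : {homo y : i j / i < j >-> (i < j)%O}.
  by apply: homo_ltn => [? ? ?|i]; [exact: lt_trans|exact: up_lt].
have [i [j [/y_lt ij cij]]] := nat_pigeonhole (fun i => c a (y i)).
have [g [Gg ga gi]] := c_coloring _ _ _ _ cij.
have /E_total : between a (y i) (y i) by exact: between_right.
by move=> /(_ g Gg)[_ /(_ ga)]; rewrite gi => e; rewrite e ltxx in ij.
Qed.

Lemma primitive_dense_coloring (T : finType) (c : L -> L -> T) (a b : L) :
  pair_coloring G c -> (a < b)%O -> dense_coloring aut_orbit.
Proof.
move=> c_coloring ab; split=> [x w|x w|x y w xy].
- have [g Gg xg] := orbit_above x w ab.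
  by exists (g w) => //; exact: aut_orbit_aut.
- have [g Gg xg] := orbit_below x w ab.
  by exists (g w) => //; exact: aut_orbit_aut.
have [y' /andP[xy' y'y]] := primitive_dense c_coloring xy.
have [x' /andP[xx' x'y']] := primitive_dense c_coloring xy'.
have [g Gg /andP[x'g gy']] := interval_meets_orbit w x'y'.
exists (g w); first exact: aut_orbit_aut.
by rewrite (lt_le_trans xx' x'g) (le_lt_trans gy' y'y).
Qed.

End NoInvariantCut.
End AutomorphismGroup.

(** * Invariant quotients *)

Section InvariantQuotient.
Context {d d' : Order.disp_t} {L : orderType d} {Q : orderType d'}.
Implicit Types (g n : order_aut L) (h : order_aut Q) (x y : L) (q : Q).

Record invariant_quotient (pi : L -> Q) : Prop := InvariantQuotient {
  quotient_homo : {homo pi : x y / (x <= y)%O};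
  quotient_surj : forall q, exists x, pi x = q;
  quotient_aut : forall g x y, pi x = pi y -> pi (g x) = pi (g y)
}.

Variable pi : L -> Q.
Hypothesis pi_quotient : invariant_quotient pi.

Lemma quotient_lt x y : (pi x < pi y)%O -> (x < y)%O.
Proof. by rewrite !ltNge; apply: contra; exact: quotient_homo. Qed.

Lemma quotient_aut_inv g x y : pi y = pi (g x) -> pi ((g^-1)%g y) = pi x.
Proof. by move=> /(quotient_aut pi_quotient g^-1%g); rewrite autK. Qed.

Lemma quotient_aut_eq g x y : (pi (g x) == pi (g y)) = (pi x == pi y).
Proof.
apply/eqP/eqP => [/esym/quotient_aut_inv|]; last exact: quotient_aut.
by rewrite autK.
Qed.

Lemma quotient_aut_lt g x y : (pi x < pi y)%O -> (pi (g x) < pi (g y))%O.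
Proof.
move=> xy; rewrite lt_neqAle quotient_aut_eq (lt_eqF xy) /=.
by apply: quotient_homo => //; rewrite aut_mono ltW // quotient_lt.
Qed.

Definition induces g h := forall x, pi (g x) = h (pi x).

Definition induced_group : set (order_aut Q) :=
  [set h | exists g, induces g h]%classic.

Lemma induces_exists g : exists h, induces g h.
Proof.
pose R q q' := exists x, pi x = q /\ pi (g x) = q'.
have [q|q|_ _ _ _ [x [<- <-]] [x' [<- <-]]|h hR] := @order_relation_aut _ Q R.
- by have [x <-] := quotient_surj pi_quotient q; exists (pi (g x)), x.
- have [x <-] := quotient_surj pi_quotient q.
  by exists (pi (g^-1%g x)), (g^-1%g x); rewrite autVK.
- have [|/(quotient_aut_lt g)/lt_geF->//|] := ltgtP (pi x) (pi x').
    by move=> /(quotient_aut_lt g)/ltW->.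
  by move=> /(quotient_aut pi_quotient g)->; rewrite lexx.
by exists h => x; apply/esym/hR; exists x.
Qed.

Lemma inducesM g g' h h' :
  induces g h -> induces g' h' -> induces (g * g')%g (h * h')%g.
Proof. by move=> gh g'h' x; rewrite !autME gh g'h'. Qed.

Lemma inducesV g h : induces g h -> induces (g^-1)%g (h^-1)%g.
Proof. by move=> gh x; rewrite -{2}[x](autVK g) gh autK. Qed.

Lemma induced_group_subgroup : is_subgroup induced_group.
Proof.
split=> [|h h' [g gh] [g' gh']|h [g gh]]; first by exists 1%g.
  by exists (g * g')%g; exact: inducesM.
by exists (g^-1)%g; exact: inducesV.
Qed.

Lemma glue_aut (f : Q -> order_aut L) h :
  (forall x, pi (f (pi x) x) = h (pi x)) ->
  exists g, forall x, g x = f (pi x) x.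
Proof.
move=> fh; pose R x y := f (pi x) x = y.
have [x|y|x _ x' _ <- <-|g gR] := @order_relation_aut _ L R; last first.
- by exists g => x; exact: gR.
- have f_lt u u' : (pi u < pi u')%O ->
      (u < u')%O /\ (f (pi u) u < f (pi u') u')%O.
    by move=> uu'; split; apply: quotient_lt; rewrite // !fh aut_lt.
  have [/f_lt[xx' fxx']|/f_lt[x'x fx'x]|->] := ltgtP (pi x) (pi x').
  + by rewrite (ltW xx') (ltW fxx').
  + by rewrite (lt_geF x'x) (lt_geF fx'x).
  + by rewrite aut_mono.
- have [x0 x0y] := quotient_surj pi_quotient ((h^-1)%g (pi y)).
  have fx0 : pi (f (pi x0) x0) = pi y by rewrite fh x0y autVK.
  exists (((f (pi x0))^-1)%g y); rewrite /R (quotient_aut_inv (esym fx0)).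
  by rewrite autVK.
- by exists (f (pi x) x).
Qed.

Definition kernel : set (order_aut L) :=
  [set g | forall x, pi (g x) = pi x]%classic.

Lemma kernel_aut n g : kernel n -> kernel (g^-1 * n * g)%g.
Proof.
by move=> n_ker x; apply: quotient_aut_inv => //; rewrite autME n_ker.
Qed.

Lemma kernel_factor g (a : seq L) : {in a, forall x, pi (g x) = pi x} ->
  exists v n : order_aut L,
    [/\ kernel n, {in a, forall x, v x = x} & g = (v * n)%g].
Proof.
move=> g_fix; pose f q := if q \in map pi a then g else 1%g.
have f_fix x : pi (f (pi x) x) = pi x.
  rewrite /f; case: ifP => // /mapP[y ya xy].
  by rewrite xy -(g_fix y ya); exact: quotient_aut.
have [n nP] := glue_aut (h := 1%g) f_fix.
exists (g * n^-1)%g, n; split=> [x|x xa|]; last by rewrite mulgVK.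
  by rewrite nP f_fix.
have gV_fix : pi ((g^-1)%g x) = pi x.
  by apply: quotient_aut_inv => //; rewrite g_fix.
have nV : (n^-1)%g x = (g^-1)%g x.
  apply: (can_inj (autK n)); rewrite autVK nP gV_fix /f map_f //.
  by rewrite autVK.
by rewrite autME nV autVK.
Qed.

Lemma induced_groupP h :
  induced_group h <-> color_preserving (aut_orbit (induced_group)) h.
Proof.
have group := induced_group_subgroup.
split=> [h_ind q|h_col]; first exact: aut_orbit_aut.
have /choice[f fP] q : exists g, forall x, pi x = q -> pi (g x) = h q.
  have : aut_orbit (induced_group) q (h q).
    by rewrite -h_col; exact: aut_orbit_refl.
  by case=> h' [g gh'] h'q; exists g => x xq; rewrite gh' xq.
have [x|g gP] := glue_aut (f := f) (h := h); first exact: fP.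
by exists g => x; rewrite gP; exact: fP.
Qed.

Definition fiber q := suborder (fun x => pi x == q).

Lemma fiber_convex q x y z : pi x == q -> pi z == q ->
  (x <= y)%O -> (y <= z)%O -> pi y == q.
Proof.
move=> /eqP xq /eqP zq xy yz; rewrite eq_le -{1}zq -xq.
by rewrite !(quotient_homo pi_quotient).
Qed.

Lemma fiber_pair_coloring (m : nat) (c : L -> L -> 'I_m.+1) a b q :
  pair_coloring (all_aut L) c -> pi a <> pi b ->
  exists c' : fiber q -> fiber q -> 'I_m, pair_coloring (all_aut (fiber q)) c'.
Proof.
move=> c_coloring nab.
have c_neq (u v : fiber q) : c a b != c (val u) (val v).
  apply/eqP => /c_coloring[g [_ ga gb]]; apply: nab; apply/eqP.
  rewrite -(quotient_aut_eq g) ga gb.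
  by rewrite (eqP (valP u)) (eqP (valP v)).
exists (fun u v => s2val (unlift_some (c_neq u v))) => u v u' v' uv.
have /c_coloring[g [_ gu gv]] : c (val u) (val v) = c (val u') (val v').
  by rewrite (s2valP (unlift_some (c_neq u v))) uv -(s2valP (unlift_some _)).
have [x|h hE] := @restrict_aut _ _ (fun x => pi x == q) g; last first.
  by exists h; split=> //; apply: val_inj; rewrite hE.
have pi_u : pi (val u) = q := eqP (valP u).
have pi_u' : pi (val u') = q := eqP (valP u').
by rewrite -{1}pi_u' -gu quotient_aut_eq pi_u.
Qed.

End InvariantQuotient.

(** * The primitive quotient *)

Lemma cut_quotient d (L : orderType d) I : invariant_cut (all_aut L) I ->
  exists2 pi : L -> bool, invariant_quotient pi /\ (exists x y, pi x <> pi y) &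
    kernel pi = all_aut L.
Proof.
move=> [I_down I_aut [x0 Ix0] [x1 Ix1]]; pose pi x := ~~ `[< I x >].
have pi0 : pi x0 = false by rewrite /pi asboolT.
have pi1 : pi x1 = true by rewrite /pi asboolF.
have pi_aut (g : order_aut L) x : pi (g x) = pi x.
  congr (~~ _); apply: asbool_equiv_eq; split=> [Igx|]; last exact: I_aut.
  by rewrite -[x](autK g); exact: I_aut.
exists pi; last by apply/seteqP; split=> // g _ x; exact: pi_aut.
split; last by exists x0, x1; rewrite pi0 pi1.
split=> [x y xy|[]|g x y]; last by rewrite !pi_aut.
- rewrite /pi; case: asboolP => // nIx; case: asboolP => // Iy.
  by case: nIx; exact: I_down xy.
- by exists x1.
- by exists x0.
Qed.

Lemma congruence_quotient d (L : orderType d) (E : L -> L -> Prop) :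
  convex_congruence (all_aut L) E ->
  exists (Q : orderType (Order.Disp tt tt)) (pi : L -> Q),
    invariant_quotient pi /\ forall x y, pi x = pi y <-> E x y.
Proof.
move=> [E_refl E_sym E_trans E_convex E_aut].
pose leE (x y : L) := (x <= y)%O || `[< E x y >].
have leE_trans : transitive leE.
  move=> y x z /orP[xy|/asboolP xy] /orP[yz|/asboolP yz]; apply/orP.
  - by left; exact: le_trans xy yz.
  - have [|/ltW zx] := leP x z; [by left|right; apply/asboolP].
    exact/E_sym/(E_convex _ _ y)/xy/zx/E_sym.
  - have [|/ltW zx] := leP x z; [by left|right; apply/asboolP].
    by apply: (E_trans _ _ _ xy); apply: E_convex (E_sym _ _ xy) yz zx.
  - by right; apply/asboolP; exact: E_trans xy yz.
have leE_total : total leE.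
  by move=> x y; rewrite /leE; case: (leP x y) => //= /ltW->; rewrite orbT.
have [Q [pi [pi_le pi_surj]]] := preorder_quotientP leE_trans leE_total.
have piE x y : pi x = pi y <-> E x y.
  split=> [/eqP|xy]; last first.
    by apply/le_anti; rewrite !pi_le /leE !asboolT ?orbT //; exact: E_sym.
  rewrite eq_le !pi_le.
  move=> /andP[/orP[xy|/asboolP //] /orP[yx|/asboolP/E_sym //]].
  by have -> : x = y by apply/le_anti; rewrite xy yx.
exists Q, pi; split=> //; split=> // [x y xy|g x y /piE xy].
  by rewrite pi_le /leE xy.
exact/piE/E_aut.
Qed.

Lemma maximal_congruence d (L : orderType d) (T : finType) (c : L -> L -> T)
    (a b : L) :
  pair_coloring (all_aut L) c -> a <> b ->
  exists E, [/\ convex_congruence (all_aut L) E, exists x y, ~ E x y &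
    forall E', convex_congruence (all_aut L) E' -> (exists x y, ~ E' x y) ->
      (forall x y, E x y -> E' x y) -> forall x y, E' x y -> E x y].
Proof.
move=> c_coloring nab.
pose colors (E : L -> L -> Prop) :=
  [set t | `[< exists x y, E x y /\ c x y = t >]].
pose P A := `[< exists E,
  [/\ convex_congruence (all_aut L) E, exists x y, ~ E x y & colors E = A] >].
have [|A /maxsetP[/asboolP[E [E_cong E_proper <-]] E_max]] := @ex_maxset _ P.
  exists (colors eq); apply/asboolP; exists eq.
  by split=> //; [exact: eq_congruence|exists a, b].
exists E; split=> // E' E'_cong E'_proper EE' x y xy.
have /(congr1 (fun A : {set T} => c x y \in A)) : colors E' = colors E.
  apply: E_max; first by apply/asboolP; exists E'.
  apply/fintype.subsetP => t; rewrite !inE => -[u [v [uv <-]]].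
  by exists u, v; split=> //; exact: EE'.
rewrite !inE asboolT; last by exists x, y.
move=> /esym/asboolP[u [v [uv /c_coloring[g [_ <- <-]]]]].
exact: (congruence_aut E_cong).
Qed.

Section PrimitiveQuotient.
Context {d d' : Order.disp_t} {L : orderType d} {Q : orderType d'}.
Variable pi : L -> Q.
Hypothesis pi_quotient : invariant_quotient pi.

Lemma pullback_congruence E : convex_congruence (induced_group pi) E ->
  convex_congruence (all_aut L) (fun x y => E (pi x) (pi y)).
Proof.
move=> [E_refl E_sym E_trans E_convex E_aut]; split=> //.
- by move=> x y; exact: E_sym.
- by move=> y x z; exact: E_trans.
- by move=> x y z xz xy yz; apply: E_convex xz _ _; exact: quotient_homo.
- move=> g x y _ xy; have [h gh] := induces_exists pi_quotient g.
  by rewrite !gh; apply: E_aut => //; exists g.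
Qed.

Lemma pullback_cut I : invariant_cut (induced_group pi) I ->
  invariant_cut (all_aut L) [set x | I (pi x)]%classic.
Proof.
move=> [I_down I_aut [p Ip] [q Iq]]; split=> /= [x y Iy xy|g x _ Ix||].
- by apply: I_down Iy _; exact: quotient_homo.
- have [h gh] := induces_exists pi_quotient g.
  by rewrite gh; apply: I_aut => //; exists g.
- by have [x xp] := quotient_surj pi_quotient p; exists x; rewrite xp.
- by have [x xq] := quotient_surj pi_quotient q; exists x; rewrite xq.
Qed.

Lemma quotient_pair_coloring (T : Type) (c : L -> L -> T) :
  pair_coloring (all_aut L) c ->
  exists c' : Q -> Q -> T, pair_coloring (induced_group pi) c'.
Proof.
move=> c_coloring; have /choice[r rK] := quotient_surj pi_quotient.
exists (fun p q => c (r p) (r q)) => p q p' q' /c_coloring[g [_ gp gq]].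
have [h gh] := induces_exists pi_quotient g; exists h; split; first by exists g.
  by rewrite -[p]rK -gh gp rK.
by rewrite -[q]rK -gh gq rK.
Qed.

Lemma quotient_countable : countable [set: L] -> countable [set: Q].
Proof.
move=> /countable_injP[f f_inj].
have /choice[r rK] := quotient_surj pi_quotient.
apply/countable_injP; exists (f \o r) => p q _ _ /f_inj pq.
by rewrite -[p]rK -[q]rK pq // inE.
Qed.

End PrimitiveQuotient.

Lemma primitive_quotient d (L : orderType d) (T : finType) (c : L -> L -> T)
    (a b : L) :
  pair_coloring (all_aut L) c -> a <> b ->
  exists (Q : orderType (Order.Disp tt tt)) (pi : L -> Q),
    [/\ invariant_quotient pi, exists x y, (pi x < pi y)%O &
      primitive (induced_group pi)].
Proof.
move=> c_coloring nab.
have [E [E_cong [x [y nxy]] E_max]] := maximal_congruence c_coloring nab.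
have [Q [pi [pi_quotient piE]]] := congruence_quotient E_cong.
exists Q, pi; split=> // [|E' E'_cong].
  have [xy|yx|/piE //] := ltgtP (pi x) (pi y); first by exists x, y.
  by exists y, x.
have lift q := quotient_surj pi_quotient q.
have [E'_total|E'_proper] := pselect (forall u v, E' (pi u) (pi v)).
  right=> p q; have [u <-] := lift p; have [v <-] := lift q; exact: E'_total.
left=> p q; have [u <-] := lift p; have [v <-] := lift q => uv.
apply/piE; apply: (E_max _ (pullback_congruence pi_quotient E'_cong)) uv.
  apply: contrapT => nE'; apply: E'_proper => u' v'.
  by apply: contrapT => nu'v'; apply: nE'; exists u', v'.
by move=> u' v' /piE ->; exact: (congruence_refl E'_cong).
Qed.

Lemma dense_quotient d (L : orderType d) (T : finType) (c : L -> L -> T)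
    (a b : L) :
  pair_coloring (all_aut L) c -> a <> b ->
  (forall I, ~ invariant_cut (all_aut L) I) ->
  exists (Q : orderType (Order.Disp tt tt)) (pi : L -> Q),
    [/\ invariant_quotient pi, exists x y, pi x <> pi y &
      dense_coloring (aut_orbit (induced_group pi))].
Proof.
move=> c_coloring nab no_cut.
have [Q [pi [pi_quotient [x [y xy]] pi_primitive]]] :=
  primitive_quotient c_coloring nab.
exists Q, pi; split=> //; first by exists x, y => e; rewrite e ltxx in xy.
have [c' c'_coloring] := quotient_pair_coloring pi_quotient c_coloring.
apply: primitive_dense_coloring c'_coloring xy => //.
  exact: induced_group_subgroup.
by move=> I /(pullback_cut pi_quotient); exact: no_cut.
Qed.

(** * Actions on compact spaces *)

Local Open Scope classical_set_scope.

Section Compactness.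
Variable X : topologicalType.

Lemma compact_finite_cover (K : set X) (I : eqType) (O : I -> set X) :
  compact K -> (forall y, K y -> exists i, nbhs y (O i)) ->
  exists s : seq I, forall y, K y -> exists2 i, i \in s & O i y.
Proof.
move=> /compact_near_coveringP K_cover O_nbhs.
pose F := filter_from [set: seq I] (fun s => [set t : seq I | {subset s <= t}]).
have F_filter : Filter F.
  apply: filter_from_filter; first by exists [::].
  move=> s t _ _; exists (s ++ t) => // r r_st; split=> i ist; apply: r_st.
    by rewrite mem_cat ist.
  by rewrite mem_cat ist orbT.
pose covered (s : seq I) y := exists2 i, i \in s & O i y.
have [y Ky|s _ sP] := K_cover _ F covered F_filter.
  have [i Oi] := O_nbhs y Ky.
  exists (O i, [set t : seq I | i \in t]); last first.
    by move=> [z t] /= [Oz it]; exists i.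
  by split=> //; exists [:: i] => // t; apply; rewrite inE.
by exists s => y; exact: sP.
Qed.

Lemma compact_finite_intersection (K : set X) (I : eqType) (C : I -> set X) :
  compact K -> (forall i, closed (C i)) ->
  (forall s : seq I, exists2 y, K y & forall i, i \in s -> C i y) ->
  exists2 y, K y & forall i, C i y.
Proof.
move=> K_compact C_closed fip; apply: contrapT => nC.
have [y Ky|s sP] := compact_finite_cover (O := fun i => ~` C i) K_compact.
  apply: contrapT => /forallNP nO; apply: nC; exists y => // i.
  apply: contrapT => nCy; apply: (nO i).
  by apply: open_nbhs_nbhs; split=> //; exact: closed_openC.
by have [y Ky yC] := fip s; have [i /yC] := sP y Ky.
Qed.

Lemma compact_set_type (K : set X) : compact K -> compact [set: K].
Proof.
move=> K_compact F F_proper _.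
have FK : F (set_val @^-1` K) by apply: filterS filterT => u _; exact: set_valP.
have [y [Ky y_cluster]] := K_compact (set_val @ F) _ FK.
exists (SigSub (mem_set Ky)); split=> // A B FA [_ [[W W_open <-] Wy WB]].
have F_image : F (set_val @^-1` (set_val @` A)).
  by apply: filterS FA => u Au; exists u.
have W_nbhs : nbhs y W by exact: open_nbhs_nbhs.
have [z [[u Au uz] Wz]] := y_cluster _ W F_image W_nbhs.
by exists u; split=> //; apply: WB; rewrite /= uz.
Qed.

Lemma injective_hausdorff (Y : topologicalType) (f : X -> Y) :
  hausdorff_space Y -> continuous f -> injective f -> hausdorff_space X.
Proof.
move=> Y_hausdorff f_cont f_inj x y xy; apply/f_inj/Y_hausdorff => A B fxA fyB.
by have [z [Az Bz]] := xy _ _ (f_cont _ _ fxA) (f_cont _ _ fyB); exists (f z).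
Qed.

Lemma closed_equalizer (Y : topologicalType) (f g : X -> Y) :
  hausdorff_space Y -> continuous f -> continuous g ->
  closed [set x | f x = g x].
Proof.
move=> Y_hausdorff f_cont g_cont x x_closure; apply: Y_hausdorff => A B fxA gxB.
have fA : nbhs x (f @^-1` A) by exact: f_cont.
have gB : nbhs x (g @^-1` B) by exact: g_cont.
have [z [/= fz [Az Bz]]] := x_closure _ (filterI fA gB).
by exists (f z); split=> //; rewrite fz.
Qed.

End Compactness.

Section Actions.
Context {G : topologicalGroupType} {X : topologicalType} (act : G -> X -> X).
Hypotheses (X_compact : compact [set: X]) (X_hausdorff : hausdorff_space X).
Hypothesis act_cont : continuous_action act.
Implicit Types (g h : G) (H : set G) (x y : X).

Lemma act1 x : act 1%g x = x.
Proof. by have [a1 _ _] := act_cont; exact: a1. Qed.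

Lemma actM g h x : act (g * h)%g x = act g (act h x).
Proof. by have [_ aM _] := act_cont; exact: aM. Qed.

Lemma actVK g : cancel (act g^-1%g) (act g).
Proof. by move=> x; rewrite -actM mulgV act1. Qed.

Lemma continuous_act2 (T : topologicalType) (f : T -> G) (k : T -> X) :
  continuous f -> continuous k -> continuous (fun t => act (f t) (k t)).
Proof.
have [_ _ cont] := act_cont; move=> f_cont k_cont t.
exact: (@continuous2_cvg _ G X X _ _ f k act _ _ (cont (f t, k t))
  (f_cont t) (k_cont t)).
Qed.

Lemma continuous_act g : continuous (act g).
Proof. by apply: continuous_act2 => x; [exact: cvg_cst|exact: cvg_id]. Qed.

Lemma continuous_act_point x : continuous (act ^~ x).
Proof. by apply: continuous_act2 => g; [exact: cvg_id|exact: cvg_cst]. Qed.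

Definition fixed_points H : set X := [set y | forall g, H g -> act g y = y].

Lemma closed_fixed_points H : closed (fixed_points H).
Proof.
rewrite (_ : fixed_points H = \bigcap_(g in H) [set y | act g y = y]) //.
apply: closed_bigI => g _.
by apply: closed_equalizer => // x; [exact: continuous_act|exact: cvg_id].
Qed.

Lemma closed_stabilizer y : closed [set g | act g y = y].
Proof.
apply: closed_equalizer => // g; first exact: continuous_act_point.
exact: cvg_cst.
Qed.

Lemma fixed_points_normal H g y : (forall n, H n -> H (g^-1 * n * g)%g) ->
  fixed_points H y -> fixed_points H (act g y).
Proof.
move=> H_normal y_fixed n Hn.
by rewrite -[in RHS](y_fixed _ (H_normal _ Hn)) !actM actVK.
Qed.

Lemma extremely_amenable_closed (Y : set X) : extremely_amenable G ->
  closed Y -> Y !=set0 -> (forall g y, Y y -> Y (act g y)) ->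
  exists2 y, Y y & fixed_points setT y.
Proof.
move=> G_ea Y_closed [y0 Yy0] Y_inv.
pose actY g (u : Y) : Y := SigSub (mem_set (Y_inv g _ (set_valP u))).
have val_cont : continuous (set_val : Y -> X) by exact: initial_continuous.
have [||||u u_fixed] := G_ea Y _ _ _ actY.
- by exists (SigSub (mem_set Yy0)).
- by apply: compact_set_type; exact: subclosed_compact Y_closed X_compact _.
- exact: injective_hausdorff X_hausdorff val_cont val_inj.
- split=> [u|g h u|]; [exact/val_inj/act1|exact/val_inj/actM|].
  apply: continuous_comp_initial; apply: continuous_act2 => -[g u].
    exact: cvg_fst.
  by apply: continuous_comp; [exact: cvg_snd|exact: val_cont].
exists (set_val u) => [|g _]; first exact: set_valP.
by rewrite -[in RHS](u_fixed g).
Qed.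

Definition ramsey_subgroup H := is_subgroup H /\
  forall (T : finType) (chi : G -> T) (F : seq G),
    (forall g h, H h -> chi (g * h)%g = chi g) ->
    exists g, {in F, forall f, chi (g * f)%g = chi g}.

Definition separates g (V : set G) (O : set X) := forall v v' y y',
  V v -> V v' -> O y -> O y' -> act g (act v y) <> act v' y'.

Lemma moved_separates g x : act g x <> x ->
  exists V O, [/\ nbhs 1%g V, nbhs x O & separates g V O].
Proof.
move=> /eqP gx; move: X_hausdorff; rewrite open_hausdorff => /(_ _ _ gx).
move=> [[A B] /= [gxA xB] [A_open B_open /eqP AB]]; rewrite !inE in gxA xB.
have W_nbhs : nbhs (act 1%g x) (act g @^-1` A `&` B).
  rewrite act1; apply: filterI; last exact: open_nbhs_nbhs.
  by apply: continuous_act; exact: open_nbhs_nbhs.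
have [_ _ /(_ (1%g, x) _ W_nbhs)[[V O] /= [V1 Ox] VO]] := act_cont.
exists V, O; split=> // v v' y y' Vv Vv' Oy Oy' e.
have [Agv _] := VO (v, y) (conj Vv Oy).
have [_ Bv'] := VO (v', y') (conj Vv' Oy').
suff: (A `&` B) (act v' y') by rewrite AB.
by split=> //; rewrite -e.
Qed.

Lemma separating_cover (Y : set X) :
  closed Y -> (forall y, Y y -> exists g, act g y <> y) ->
  exists n (f : 'I_n -> G) (O : 'I_n -> set X) (V : set G),
    [/\ nbhs 1%g V, forall i, separates (f i) V (O i) &
      forall y, Y y -> exists i, O i y].
Proof.
move=> Y_closed Y_moved; pose separating (p : G * set G * set X) :=
  nbhs 1%g p.1.2 /\ separates p.1.1 p.1.2 p.2.
have Y_compact := subclosed_compact Y_closed X_compact (@subsetT _ Y).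
have [y Yy|s s_cover] := compact_finite_cover
    (O := fun p => [set y | separating p /\ p.2 y]) Y_compact.
  have [g /moved_separates[V [O [V1 yO VO]]]] := Y_moved y Yy.
  by exists (g, V, O); apply: filterS yO.
pose t := [seq p <- s | `[< separating p >]]; pose p i := tnth (in_tuple t) i.
have p_separating i : separating (p i).
  by have := mem_tnth i (in_tuple t); rewrite mem_filter => /andP[/asboolP].
exists (size t), (fun i => (p i).1.1), (fun i => (p i).2),
  [set v | forall i, (p i).1.2 v]; split=> [|i v v' y y' Vv Vv'|y /s_cover].
- by apply: filter_forall => i; exact: (p_separating i).1.
- by apply: (p_separating i).2; [exact: Vv|exact: Vv'].
move=> [q qs [q_separating qy]].
have /(tnthP (in_tuple t))[i qE] : q \in t.
  by rewrite mem_filter qs andbT; exact/asboolP.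
by exists i; rewrite /p -qE.
Qed.

Definition pulls_into (y0 : X) H (O : set X) g :=
  exists h y, [/\ H h, O y & act g^-1%g y0 = act h y].

Lemma pulls_into_mulr (y0 : X) H (O : set X) g h : is_subgroup H -> H h ->
  pulls_into y0 H O (g * h)%g <-> pulls_into y0 H O g.
Proof.
move=> [_ HM HV] Hh.
have mulr g' h' : H h' -> pulls_into y0 H O g' -> pulls_into y0 H O (g' * h')%g.
  move=> Hh' [k [y [Hk Oy e]]]; exists (h'^-1 * k)%g, y.
  by split=> //; [apply: HM => //; exact: HV|rewrite invgM !actM e].
split; last exact: mulr.
by move=> /(mulr _ _ (HV _ Hh)); rewrite mulgK.
Qed.

(* Cover Y by finitely many sets O_i, each separated from its translate by some
   f_i, and colour g by the set of those i for which g^-1 y0 lies in H O_i. *)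
Lemma ramsey_fixed_point (Y : set X) :
  closed Y -> Y !=set0 -> (forall g y, Y y -> Y (act g y)) ->
  (forall V, nbhs 1%g V -> exists2 H, ramsey_subgroup H &
    forall h y, H h -> Y y -> exists2 v, V v & act h y = act v y) ->
  exists2 y, Y y & fixed_points setT y.
Proof.
move=> Y_closed [y0 Yy0] Y_inv V_ramsey; apply: contrapT => no_fixed.
have [y Yy|n [f [O [V [V1 O_separates O_cover]]]]] := separating_cover Y_closed.
  apply: contrapT => /forallNP y_fixed; apply: no_fixed.
  by exists y => // g _; exact: contrapT.
have [H [H_subgroup H_ramsey] H_absorb] := V_ramsey V V1.
pose pulls i := pulls_into y0 H (O i `&` Y).
have [|g gF] := H_ramsey _ (fun g => [set i | `[< pulls i g >]]%SET)
    [seq (f i)^-1%g | i <- enum 'I_n].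
  move=> g h Hh; apply/setP => i; rewrite !inE.
  by apply: asbool_equiv_eq; exact: pulls_into_mulr.
have [i Oi] := O_cover _ (Y_inv g^-1%g _ Yy0).
have pulls_g : pulls i g.
  have [H1 _ _] := H_subgroup; exists 1%g, (act g^-1%g y0); rewrite act1.
  by split=> //; split=> //; exact: Y_inv.
have pulls_gf : pulls i (g * (f i)^-1)%g.
  have /gF/setP/(_ i) : (f i)^-1%g \in [seq (f i)^-1%g | i <- enum 'I_n].
    by apply: map_f; rewrite mem_enum.
  by rewrite !inE => e; apply/asboolP; rewrite e; exact/asboolP.
have [h [y [Hh [Oy Yy] e]]] := pulls_g.
have [h' [y' [Hh' [Oy' Yy'] e']]] := pulls_gf.
have [v Vv hv] := H_absorb _ _ Hh Yy; have [v' Vv' hv'] := H_absorb _ _ Hh' Yy'.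
apply: (O_separates i v v' y y') => //.
by rewrite -hv -hv' -e -e' invgM invgK actM.
Qed.

End Actions.

(** * Extreme amenability *)

Lemma nbhs_aut d (L : orderType d) (g : order_aut L) (V : set (order_aut L)) :
  nbhs g V -> exists a : seq L, forall h : order_aut L, {in a, h =1 g} -> V h.
Proof.
pose agree (a : seq L) := [set h : order_aut L | {in a, h =1 g}].
pose F := filter_from [set: seq L] agree.
have F_filter : Filter F.
  apply: filter_from_filter; first by exists [::].
  move=> a b _ _; exists (a ++ b) => // h h_ab.
  by split=> x xs; apply: h_ab; rewrite mem_cat xs ?orbT.
have F_cvg : aut_ptws @ F --> aut_ptws g.
  apply/cvg_sup => x A [_ [[W _ <-] /= Wx] WA].
  exists [:: x] => // h h_x; apply: WA.
  by rewrite /= /aut_ptws h_x // inE.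
move=> [_ [[W W_open <-]] /= Wg WV].
have [a _ aW] : (aut_ptws @ F) W by apply: F_cvg; exact: open_nbhs_nbhs.
by exists a => h h_a; apply: WV; exact: aW.
Qed.

Lemma closed_aut_agree d (L : orderType d) (A : set (order_aut L))
    (g : order_aut L) :
  closed A -> (forall a : seq L, exists2 h, A h & {in a, h =1 g}) -> A g.
Proof.
move=> A_closed A_agree; apply: A_closed => V /nbhs_aut[a aV].
by have [h Ah h_a] := A_agree a; exists h; split=> //; exact: aV.
Qed.

Section FiberActions.
Context {d d' : Order.disp_t} {L : orderType d} {Q : orderType d'}.
Variable pi : L -> Q.
Hypothesis pi_quotient : invariant_quotient pi.

Definition fiber_extension q : order_aut (fiber pi q) -> order_aut L :=
  extension (@fiber_convex _ _ _ _ _ pi_quotient q).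

Arguments fiber_extension q h : clear implicits.

Lemma fiber_extension_out q h x : pi x != q -> fiber_extension q h x = x.
Proof. exact: (@extension_out _ _ (fun x => pi x == q)). Qed.

Lemma fiber_extension_eq q h x :
  (pi (fiber_extension q h x) == q) = (pi x == q).
Proof. exact: (@extension_pred _ _ (fun x => pi x == q)). Qed.

Lemma fiber_extension_commute q q' h h' : q != q' ->
  (fiber_extension q h * fiber_extension q' h' =
   fiber_extension q' h' * fiber_extension q h)%g.
Proof.
move=> qq'; apply: order_autP => x; rewrite !autME.
have [xq|xq] := eqVneq (pi x) q.
  have := fiber_extension_eq h x; rewrite xq eqxx => /eqP hx.
  by rewrite ![fiber_extension q' h' _]fiber_extension_out ?hx ?xq.
rewrite [fiber_extension q h x]fiber_extension_out //.
rewrite fiber_extension_out //; have [xq'|xq'] := eqVneq (pi x) q'.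
  have := fiber_extension_eq h' x; rewrite xq' eqxx => /eqP->.
  by rewrite eq_sym.
by rewrite fiber_extension_out.
Qed.

Lemma kernel_fiber_extension q g : kernel pi g ->
  exists h, forall x,
    fiber_extension q h x = if pi x == q then g x else x.
Proof.
move=> g_ker; have [x|h hE] := @restrict_aut _ _ (fun x => pi x == q) g.
  by rewrite g_ker.
exists h => x; case: ifP => [xq|/negbT]; last exact: fiber_extension_out.
by rewrite -[x](SubK (fiber pi q) xq) /fiber_extension extension_in hE.
Qed.

Context {X : topologicalType} {act : order_aut L -> X -> X}.
Hypotheses (X0 : [set: X] !=set0) (X_compact : compact [set: X]).
Hypotheses (X_hausdorff : hausdorff_space X) (act_cont : continuous_action act).
Hypothesis fiber_amenable :
  forall q, extremely_amenable (order_aut (fiber pi q)).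

Definition fiber_fixed q := fixed_points act (range (fiber_extension q)).

Lemma fiber_action q :
  continuous_action
    (fun h : order_aut (fiber pi q) => act (fiber_extension q h)).
Proof.
split=> [x|h h' x|].
- by rewrite /fiber_extension extension1 (act1 act_cont).
- by rewrite /fiber_extension extensionM (actM act_cont).
- apply: (continuous_act2 act_cont) => -[h x]; last exact: cvg_snd.
  by apply: continuous_comp; [exact: cvg_fst|exact: continuous_extension].
Qed.

Lemma finitely_many_fibers_fixed (qs : seq Q) :
  exists y, forall q, q \in qs -> fiber_fixed q y.
Proof.
elim: qs => [|q qs [y y_fixed]]; first by have [y _] := X0; exists y.
have [q_qs|q_qs] := boolP (q \in qs).
  by exists y => q'; rewrite inE => /predU1P[->|]; exact: y_fixed.
pose Y := \bigcap_(q' in [set` qs]) fiber_fixed q'.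
have [||h z z_fixed q' q'_qs _ [h' _ <-]|z z_fixed z_q] :=
    extremely_amenable_closed X_compact X_hausdorff (fiber_action q) (Y := Y)
      (@fiber_amenable q).
- by apply: closed_bigI => q' _; exact: closed_fixed_points.
- by exists y.
- have qq' : q' != q by apply: contraNneq q_qs => <-.
  rewrite -(actM act_cont) fiber_extension_commute // (actM act_cont).
  by congr act; apply: (z_fixed q' q'_qs); exists h'.
exists z => q'; rewrite inE => /predU1P[->|/z_fixed //] _ [h _ <-].
exact: z_q.
Qed.

(* The automorphisms supported on one fiber generate a dense subgroup of the
   kernel. *)
Lemma kernel_agrees_fixing y (g : order_aut L) (qs : seq Q) :
  (forall q, fiber_fixed q y) -> kernel pi g ->
  exists2 n : order_aut L, act n y = y &
    forall x, n x = if pi x \in qs then g x else x.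
Proof.
move=> y_fixed g_ker; elim: qs => [|q qs [n ny nE]].
  by exists 1%g; first exact: act1.
have [q_qs|q_qs] := boolP (q \in qs).
  by exists n => // x; rewrite nE inE; case: eqVneq => // ->; rewrite q_qs.
have [h hE] := kernel_fiber_extension q g_ker.
exists (fiber_extension q h * n)%g => [|x].
  by rewrite (actM act_cont) ny; apply: (y_fixed q); exists h.
rewrite autME hE nE inE; have [xq|xq] := eqVneq (pi x) q.
  by rewrite xq (negbTE q_qs) xq eqxx.
by case: (pi x \in qs); rewrite ?g_ker (negbTE xq).
Qed.

Lemma kernel_fixed_point : fixed_points act (kernel pi) !=set0.
Proof.
have [q|qs|y _ y_fixed] := compact_finite_intersection
    (C := fiber_fixed) X_compact.
- exact: closed_fixed_points.
- by have [y] := finitely_many_fibers_fixed qs; exists y.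
exists y => g g_ker; apply: (@closed_aut_agree _ _ [set n | act n y = y] g).
  exact: closed_stabilizer.
move=> a; have [n ny nE] := kernel_agrees_fixing (map pi a) y_fixed g_ker.
by exists n => // x xa; rewrite nE map_f.
Qed.

End FiberActions.

Section DenseQuotient.
Context {d d' : Order.disp_t} {L : orderType d} {Q : orderType d'}.
Variable pi : L -> Q.
Hypothesis pi_quotient : invariant_quotient pi.
Hypothesis Q_countable : countable [set: Q].
Hypothesis Q_dense : dense_coloring (aut_orbit (induced_group pi)).

Definition class_stabilizer (a : seq L) : set (order_aut L) :=
  [set g | {in a, forall x, pi (g x) = pi x}].

Lemma class_stabilizer_subgroup a : is_subgroup (class_stabilizer a).
Proof.
split=> [//|g h g_a h_a x xa|g g_a x xa].
  by rewrite autME -(g_a x xa); apply: quotient_aut; rewrite // h_a.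
by apply: quotient_aut_inv => //; rewrite g_a.
Qed.

Lemma class_stabilizer_ramsey a : ramsey_subgroup (class_stabilizer a).
Proof.
split=> [|T chi F chi_a]; first exact: class_stabilizer_subgroup.
have chi_pi (g g' : order_aut L) :
    {in a, forall x, pi (g x) = pi (g' x)} -> chi g = chi g'.
  move=> gg'; rewrite -(mulVKg g g') chi_a // => x xa.
  by apply: quotient_aut_inv => //; rewrite gg'.
have /choice[ind indP] g := induces_exists pi_quotient g.
have /choice[lift liftP] h : exists g, induced_group pi h -> induces pi g h.
  have [[g gh]|nh] := pselect (induced_group pi h); first by exists g.
  by exists 1%g.
have [h h'|_ /mapP[f fF ->]|h] := colored_ramsey Q_dense (chi := chi \o lift)
    (u := map pi a) (F := map ind F) Q_countable.
- move=> /(induced_groupP pi_quotient)/liftP h_lift.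
  move=> /(induced_groupP pi_quotient)/liftP h'_lift hh'.
  by apply: chi_pi => x xa; rewrite h_lift h'_lift hh' // map_f.
- by apply/(induced_groupP pi_quotient); exists f.
move=> /(induced_groupP pi_quotient) h_ind hF.
exists (lift h) => f fF; rewrite -[RHS](hF (ind f)) ?map_f //=.
have hf_ind : induces pi (lift h * f)%g (h * ind f)%g.
  exact: inducesM (liftP _ h_ind) (indP f).
apply: chi_pi => x _; rewrite hf_ind; apply/esym/liftP.
by exists (lift h * f)%g.
Qed.

Lemma dense_quotient_fixed_point (X : topologicalType)
    (act : order_aut L -> X -> X) :
  compact [set: X] -> hausdorff_space X -> continuous_action act ->
  fixed_points act (kernel pi) !=set0 -> exists y, forall g, act g y = y.
Proof.
move=> X_compact X_hausdorff act_cont fixed0.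
have [|g y y_fixed|V V1|y _ y_fixed] := ramsey_fixed_point X_compact X_hausdorff
    act_cont (Y := fixed_points act (kernel pi)) _ fixed0.
- exact: closed_fixed_points.
- by apply: fixed_points_normal => // n; exact: kernel_aut.
- have [a aV] := nbhs_aut V1; exists (class_stabilizer a).
    exact: class_stabilizer_ramsey.
  move=> h y h_a y_fixed.
  have [v [n [n_ker v_a ->]]] := kernel_factor pi_quotient h_a.
  exists v; first exact: aV.
  by rewrite (actM act_cont) y_fixed.
by exists y => g; exact: y_fixed.
Qed.

End DenseQuotient.

Lemma rigid_extremely_amenable d (L : orderType d) :
  (forall x y : L, x = y) -> extremely_amenable (order_aut L).
Proof.
move=> L1 X [y _] _ _ act act_cont; exists y => g.
rewrite -[RHS](act1 act_cont); congr act; exact: order_autP.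
Qed.

Lemma pair_coloring_extremely_amenable n d (L : orderType d)
    (c : L -> L -> 'I_n) :
  countable [set: L] -> pair_coloring (all_aut L) c ->
  extremely_amenable (order_aut L).
Proof.
elim: n L c => [|n IHn] L c L_countable c_coloring.
  by apply: rigid_extremely_amenable => x y; case: (c x y).
have [L1|nL1] := pselect (forall x y : L, x = y).
  exact: rigid_extremely_amenable.
have [a [b nab]] : exists a b : L, a <> b.
  by move: nL1 => /existsNP[a /existsNP[b nab]]; exists a, b.
have fiber_amenable d' (Q : orderType d') (pi : L -> Q) :
    invariant_quotient pi -> (exists x y, pi x <> pi y) ->
    forall q, extremely_amenable (order_aut (fiber pi q)).
  move=> pi_quotient [x [y xy]] q.
  have [c' c'_coloring] := fiber_pair_coloring pi_quotient q c_coloring xy.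
  apply: IHn c'_coloring; apply: suborder_countable.
  by apply: sub_countable L_countable; exact: subset_card_le.
move=> X X0 X_compact X_hausdorff act act_cont.
have [[I I_cut]|no_cut] := pselect (exists I, invariant_cut (all_aut L) I).
  have [pi [pi_quotient pi_proper] pi_kernel] := cut_quotient I_cut.
  have [y] := kernel_fixed_point pi_quotient X0 X_compact X_hausdorff act_cont
    (fiber_amenable _ _ _ pi_quotient pi_proper).
  by rewrite pi_kernel => y_fixed; exists y => g; exact: y_fixed.
have [Q [pi [pi_quotient pi_proper Q_dense]]] :=
  dense_quotient c_coloring nab (fun I I_cut => no_cut (ex_intro _ I I_cut)).
apply: (dense_quotient_fixed_point pi_quotient) => //.
  exact: quotient_countable pi_quotient L_countable.
exact: kernel_fixed_point (fiber_amenable _ _ _ pi_quotient pi_proper).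
Qed.

Theorem theorem1 (d : Order.disp_t) (L : orderType d)
  (hL : countably_categorical L) : extremely_amenable (order_aut L).
Proof.
have [n [c c_coloring]] := categorical_pair_coloring hL.
exact: pair_coloring_extremely_amenable hL.1 c_coloring.
Qed.
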